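(* Let $(\sigma,V^{(1)},V^{(2)})$ be an isometric covariant representation of the product system $\mathbb E$ over $\mathbb N_0^2$ on a Hilbert space $\mathcal H$, and let $i,j\in\{1,2\}$ with $i\neq j$. Then the joint defect operator $C(\sigma,V^{(1)},V^{(2)})$ is compact if and only if both $I_{\mathcal W_j}-\widetilde F^{(i)}\widetilde F^{(i)*}$ and $I_{E_i\otimes\mathcal W_j}-\widetilde F^{(i)*}\widetilde F^{(i)}$ are compact.
   Context: All $*$-homomorphisms and representations are nondegenerate. A $C^*$-correspondence over a $C^*$-algebra $\mathcal A$ is a Hilbert $\mathcal A$-module $F$ with a left action of $\mathcal A$ given by a $*$-homomorphism into the adjointable operators on $F$. Tensor products are interior tensor products, and for a representation $\sigma$ of $\mathcal A$ on a Hilbert space $\mathcal H$, $F\otimes\mathcal H=F\otimes_\sigma\mathcal H$ has inner product $\langle\xi_1\otimes h_1,\xi_2\otimes h_2\rangle=\langle h_1,\sigma(\langle\xi_1,\xi_2\rangle)h_2\rangle$. A (completely bounded) covariant representation of $F$ on $\mathcal H$ is a pair $(\sigma,V)$ with $\sigma:\mathcal A\to B(\mathcal H)$ a representation and $V:F\to B(\mathcal H)$ linear, completely bounded, with $V(b\xi a)=\sigma(b)V(\xi)\sigma(a)$; put $\widetilde V:F\otimes\mathcal H\to\mathcal H$, $\widetilde V(\xi\otimes h)=V(\xi)h$. It is isometric if $V(\eta)^*V(\xi)=\sigma(\langle\eta,\xi\rangle)$ (equivalently $\widetilde V$ is an isometry). A product system $\mathbb E$ over $\mathbb N_0^2$ consists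 of $C^*$-correspondences $E_1,E_2$ over $\mathcal A$ and a unitary isomorphism $t_{2,1}:E_2\otimes E_1\to E_1\otimes E_2$; $t_{1,2}=t_{2,1}^{-1}$, $E:=E_1\otimes E_2$. A covariant representation of $\mathbb E$ on $\mathcal H$ is a triple $(\sigma,V^{(1)},V^{(2)})$ where each $(\sigma,V^{(i)})$ is a covariant representation of $E_i$ and $\widetilde V^{(1)}(I_{E_1}\otimes\widetilde V^{(2)})=\widetilde V^{(2)}(I_{E_2}\otimes\widetilde V^{(1)})(t_{1,2}\otimes I_{\mathcal H})$; it is isometric if both $(\sigma,V^{(i)})$ are. Put $\widetilde V:=\widetilde V^{(1)}(I_{E_1}\otimes\widetilde V^{(2)}):E\otimes\mathcal H\to\mathcal H$ and $\mathcal W_i=\mathcal H\ominus\widetilde V^{(i)}(E_i\otimes\mathcal H)$ (which is $\sigma$-invariant). Joint defect operator: $C(\sigma,V^{(1)},V^{(2)})=I-\widetilde V^{(1)}\widetilde V^{(1)*}-\widetilde V^{(2)}\widetilde V^{(2)*}+\widetilde V\widetilde V^*$ on $\mathcal H$. Fringe operators: $\widetilde F^{(i)}:E_i\otimes\mathcal W_j\to\mathcal W_j$, $\widetilde F^{(i)}=P_{\mathcal W_j}\widetilde V^{(i)}|_{E_i\otimes\mathcal W_j}$ for $i\ne j$, where $P_{\mathcal W_j}$ is the orthogonal projection onto $\mathcal W_j$. *)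

(* Defs.v *)
From HB Require Import structures.
From mathcomp Require Import all_boot all_order all_algebra complex.
From mathcomp Require Import all_classical all_reals all_analysis.
Set Implicit Arguments.
Unset Strict Implicit.
Unset Printing Implicit Defensive.
Import Order.TTheory GRing.Theory Num.Theory.
Import numFieldNormedType.Exports.
Local Open Scope classical_set_scope.
Local Open Scope ring_scope.
Local Open Scope complex_scope.

(* Scalars are R[i], the complex numbers over R : realType.  All inner
   products are linear in the second variable. *)

(* Positivity and definiteness follow from dot_norm. *)
HB.mixin Record isHilbert (R : realType) H of CompleteNormedModule R[i] H := {
  dot : H -> H -> R[i] ;
  dot_linear : forall (x : H) (a : R[i]) (y z : H),
    dot x (a *: y + z) = a * dot x y + dot x z ;
  dot_conj : forall x y : H, dot y x = Num.conj (dot x y) ;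
  dot_norm : forall x : H, `|x| ^+ 2 = dot x x
}.

#[short(type="hilbertType")]
HB.structure Definition Hilbert (R : realType) :=
  {H of CompleteNormedModule R[i] H & isHilbert R H}.

(* C*-algebras are not assumed unital, hence do not extend MathComp rings. *)
HB.mixin Record isCStarAlgebra (R : realType) A
    of CompleteNormedModule R[i] A := {
  cmul : A -> A -> A ;
  star : A -> A ;
  cmulA : forall a b c : A, cmul a (cmul b c) = cmul (cmul a b) c ;
  cmul_linearl : forall (k : R[i]) (a b c : A),
    cmul (k *: a + b) c = k *: cmul a c + cmul b c ;
  cmul_linearr : forall (k : R[i]) (a b c : A),
    cmul a (k *: b + c) = k *: cmul a b + cmul a c ;
  star_conj_linear : forall (k : R[i]) (a b : A),
    star (k *: a + b) = Num.conj k *: star a + star b ;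
  starM : forall a b : A, star (cmul a b) = cmul (star b) (star a) ;
  starK : forall a : A, star (star a) = a ;
  cmul_norm : forall a b : A, `|cmul a b| <= `|a| * `|b| ;
  cstar_norm : forall a : A, `|cmul (star a) a| = `|a| ^+ 2
}.

#[short(type="cstarAlgType")]
HB.structure Definition CStarAlgebra (R : realType) :=
  {A of CompleteNormedModule R[i] A & isCStarAlgebra R A}.

Definition cstar_pos (R : realType) (A : cstarAlgType R) (a : A) : Prop :=
  exists b : A, a = cmul (star b) b.

(* Definiteness of ip follows from ip_norm. *)
HB.mixin Record isHilbertModule (R : realType) (A : cstarAlgType R) F
    of CompleteNormedModule R[i] F := {
  ract : F -> A -> F ;
  ip : F -> F -> A ;
  ract_linearl : forall (k : R[i]) (x y : F) (a : A),
    ract (k *: x + y) a = k *: ract x a + ract y a ;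
  ract_linearr : forall (k : R[i]) (x : F) (a b : A),
    ract x (k *: a + b) = k *: ract x a + ract x b ;
  ractM : forall (x : F) (a b : A), ract x (cmul a b) = ract (ract x a) b ;
  ip_linear : forall (x : F) (k : R[i]) (y z : F),
    ip x (k *: y + z) = k *: ip x y + ip x z ;
  ip_ract : forall (x y : F) (a : A), ip x (ract y a) = cmul (ip x y) a ;
  ip_star : forall x y : F, ip y x = star (ip x y) ;
  ip_pos : forall x : F, cstar_pos (ip x x) ;
  ip_norm : forall x : F, `|x| ^+ 2 = `|ip x x|
}.

#[short(type="hilbertModType")]
HB.structure Definition HilbertModule (R : realType) (A : cstarAlgType R) :=
  {F of CompleteNormedModule R[i] F & isHilbertModule R A F}.

Definition closed_subspace (R : realType) (H : normedModType R[i])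
    (M : set H) : Prop :=
  [/\ M 0, forall (a : R[i]) (x y : H), M x -> M y -> M (a *: x + y)
    & closed M].

Definition cspan (R : realType) (H : normedModType R[i]) (S : set H) : set H :=
  smallest (@closed_subspace R H) S.

(* lact_adj says that lact a is adjointable with adjoint lact (star a). *)
HB.mixin Record isCorrespondence (R : realType) (A : cstarAlgType R) F
    of HilbertModule R A F := {
  lact : A -> F -> F ;
  lact_linearl : forall (k : R[i]) (a b : A) (x : F),
    lact (k *: a + b) x = k *: lact a x + lact b x ;
  lact_linearr : forall (a : A) (k : R[i]) (x y : F),
    lact a (k *: x + y) = k *: lact a x + lact a y ;
  lactM : forall (a b : A) (x : F), lact (cmul a b) x = lact a (lact b x) ;
  lact_adj : forall (a : A) (x y : F), ip (lact a x) y = ip x (lact (star a) y) ;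
  lact_nondegenerate : cspan [set lact p.1 p.2 | p in @setT (A * F)] = setT
}.

#[short(type="corrType")]
HB.structure Definition Correspondence (R : realType) (A : cstarAlgType R) :=
  {F of HilbertModule R A F & isCorrespondence R A F}.

Section Operators.
Variable R : realType.

Definition bounded_op (H K : normedModType R[i]) (T : H -> K) : Prop :=
  linear T /\ continuous T.

(* The bounded operator T with T (gen s) = f s for all s.  It is unique when
   the values of gen are total in H, which is the case in every use below. *)
Definition bounded_ext (S : Type) (H K : normedModType R[i])
    (gen : S -> H) (f : S -> K) : H -> K :=
  xget (fun=> 0) [set T | bounded_op T /\ forall s, T (gen s) = f s].

Definition ortho (H : hilbertType R) (S : set H) : set H :=
  [set x | forall y, S y -> dot y x = 0].

Definition proj (H : hilbertType R) (M : set H) (x : H) : H :=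
  xget 0 [set y | M y /\ ortho M (x - y)].

(* An operator between closed subspaces M of H and N of K is represented by a
   function H -> K of which only the restriction to M matters. *)
Definition adj_on (H K : hilbertType R) (M : set H) (N : set K) (T : H -> K) :
    K -> H :=
  xget (fun=> 0) [set S | forall y, N y ->
    M (S y) /\ forall x, M x -> dot (T x) y = dot x (S y)].

Definition adj (H K : hilbertType R) (T : H -> K) : K -> H :=
  adj_on setT setT T.

Definition compact_op_on (H K : hilbertType R) (M : set H) (T : H -> K) :
    Prop :=
  compact (closure (T @` [set x | M x /\ `|x| <= 1])).

Definition compact_op (H K : hilbertType R) (T : H -> K) : Prop :=
  compact_op_on setT T.

End Operators.

Record representation (R : realType) (A : cstarAlgType R) (H : hilbertType R) :=
  Representation {
  rep_fun :> A -> H -> H ;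
  rep_bounded : forall a, bounded_op (rep_fun a) ;
  rep_linear : forall (k : R[i]) (a b : A) (h : H),
    rep_fun (k *: a + b) h = k *: rep_fun a h + rep_fun b h ;
  rep_mul : forall (a b : A) (h : H),
    rep_fun (cmul a b) h = rep_fun a (rep_fun b h) ;
  rep_star : forall (a : A) (x y : H),
    dot (rep_fun a x) y = dot x (rep_fun (star a) y) ;
  rep_nondegenerate :
    cspan [set rep_fun p.1 p.2 | p in @setT (A * H)] = setT
}.

(* Interior tensor products are given up to unitary equivalence, by the inner
   products of the elementary tensors and their totality; bilinearity and
   A-balancedness of the elementary tensors follow. *)
Record hilbert_tensor (R : realType) (A : cstarAlgType R) (H : hilbertType R)
    (F : hilbertModType A) (sigma : representation A H) := HilbertTensor {
  ht_space :> hilbertType R ;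
  htens : F -> H -> ht_space ;
  htens_dot : forall (x1 x2 : F) (h1 h2 : H),
    dot (htens x1 h1) (htens x2 h2) = dot h1 (sigma (ip x1 x2) h2) ;
  htens_total : cspan [set htens p.1 p.2 | p in @setT (F * H)] = setT
}.

Record corr_tensor (R : realType) (A : cstarAlgType R) (F G : corrType A) :=
  CorrTensor {
  ct_space :> corrType A ;
  ctens : F -> G -> ct_space ;
  ctens_ip : forall (x1 x2 : F) (y1 y2 : G),
    ip (ctens x1 y1) (ctens x2 y2) = ip y1 (lact (ip x1 x2) y2) ;
  ctens_ract : forall (x : F) (y : G) (a : A),
    ract (ctens x y) a = ctens x (ract y a) ;
  ctens_lact : forall (a : A) (x : F) (y : G),
    lact a (ctens x y) = ctens (lact a x) y ;
  ctens_total : cspan [set ctens p.1 p.2 | p in @setT (F * G)] = setT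
}.

Definition unitary_iso (R : realType) (A : cstarAlgType R) (F G : corrType A)
    (t : F -> G) (t' : G -> F) : Prop :=
  [/\ linear t /\ (forall x y, ip (t x) (t y) = ip x y),
      forall x a, t (ract x a) = ract (t x) a,
      forall a x, t (lact a x) = lact a (t x)
    & cancel t t' /\ cancel t' t].

(* The indices 0, 1 : 'I_2 stand for 1, 2. *)
Record product_system (R : realType) (A : cstarAlgType R) := ProductSystem {
  ps_corr :> 'I_2 -> corrType A ;
  ps_12 : corr_tensor (ps_corr 0) (ps_corr 1) ;
  ps_21 : corr_tensor (ps_corr 1) (ps_corr 0) ;
  ps_t21 : ps_21 -> ps_12 ;
  ps_t12 : ps_12 -> ps_21 ;
  ps_t_unitary : unitary_iso ps_t21 ps_t12
}.

Section CompletelyBounded.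
Variables (R : realType) (A : cstarAlgType R) (F : hilbertModType A).
Variable H : hilbertType R.

(* M_n(F) has the norm of operators from the Hilbert module A^n to F^n, which
   is the operator space structure F inherits from its linking algebra.  Here r
   is a real number seen in R[i]. *)
Definition mx_module_bound n (xi : 'I_n -> 'I_n -> F) (r : R[i]) : Prop :=
  forall a : 'I_n -> A,
    let y i := \sum_(j < n) ract (xi i j) (a j) in
    `|\sum_(i < n) ip (y i) (y i)|
      <= r ^+ 2 * `|\sum_(j < n) cmul (star (a j)) (a j)|.

Definition mx_op_bound n (T : 'I_n -> 'I_n -> H -> H) (r : R[i]) : Prop :=
  forall h : 'I_n -> H,
    \sum_(i < n) `|\sum_(j < n) T i j (h j)| ^+ 2
      <= r ^+ 2 * \sum_(j < n) `|h j| ^+ 2.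

Definition completely_bounded (V : F -> H -> H) : Prop :=
  exists2 M : R[i], 0 <= M &
    forall n (xi : 'I_n -> 'I_n -> F) (r : R[i]), 0 <= r ->
      mx_module_bound xi r -> mx_op_bound (fun i j => V (xi i j)) (M * r).

End CompletelyBounded.

Definition covariant (R : realType) (A : cstarAlgType R) (H : hilbertType R)
    (F : corrType A) (sigma : representation A H) (V : F -> H -> H) : Prop :=
  [/\ forall x, bounded_op (V x),
      forall (k : R[i]) (x y : F) (h : H), V (k *: x + y) h = k *: V x h + V y h,
      completely_bounded V
    & forall (a b : A) (x : F) (h : H),
        V (lact b (ract x a)) h = sigma b (V x (sigma a h))].

Section TildeOperators.
Variables (R : realType) (A : cstarAlgType R) (H : hilbertType R).
Variable sigma : representation A H.

Definition tilde (F : hilbertModType A) (K : hilbert_tensor F sigma)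
    (V : F -> H -> H) : K -> H :=
  bounded_ext (fun p : F * H => htens K p.1 p.2) (fun p => V p.1 p.2).

(* I_F (x) T for T : G (x) H -> H, with F (x) (G (x) H) identified with
   (F (x) G) (x) H. *)
Definition id_tens (F G : corrType A) (FG : corr_tensor F G)
    (KFG : hilbert_tensor FG sigma) (KF : hilbert_tensor F sigma)
    (KG : hilbert_tensor G sigma) (T : KG -> H) : KFG -> KF :=
  bounded_ext (fun p : F * G * H => htens KFG (ctens FG p.1.1 p.1.2) p.2)
              (fun p => htens KF p.1.1 (T (htens KG p.1.2 p.2))).

Definition tens_id (F G : hilbertModType A) (KF : hilbert_tensor F sigma)
    (KG : hilbert_tensor G sigma) (t : F -> G) : KF -> KG :=
  bounded_ext (fun p : F * H => htens KF p.1 p.2)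
              (fun p => htens KG (t p.1) p.2).

End TildeOperators.

Record tensor_spaces (R : realType) (A : cstarAlgType R) (H : hilbertType R)
    (E : product_system A) (sigma : representation A H) := TensorSpaces {
  ts :> forall i : 'I_2, hilbert_tensor (E i) sigma ;
  ts_12 : hilbert_tensor (ps_12 E) sigma ;
  ts_21 : hilbert_tensor (ps_21 E) sigma
}.

Record covariant_rep (R : realType) (A : cstarAlgType R) (H : hilbertType R)
    (E : product_system A) (sigma : representation A H)
    (K : tensor_spaces E sigma) := CovariantRep {
  cr_fun :> forall i : 'I_2, E i -> H -> H ;
  cr_covariant : forall i, covariant sigma (@cr_fun i) ;
  cr_comm : forall u : ts_12 K,
    tilde (@cr_fun 0) (id_tens (K 0) (tilde (K := K 1) (@cr_fun 1)) u) =
    tilde (@cr_fun 1) (id_tens (K 1) (tilde (K := K 0) (@cr_fun 0))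
      (tens_id (ts_21 K) (@ps_t12 R A E) u))
}.

Arguments cr_fun {R A H E sigma K} _ i _ _.

Section FringeOperators.
Variables (R : realType) (A : cstarAlgType R) (H : hilbertType R).
Variables (E : product_system A) (sigma : representation A H).
Variables (K : tensor_spaces E sigma) (V : covariant_rep K).

Definition isometric : Prop :=
  forall (i : 'I_2) (x y : E i) (h : H),
    adj (V i y) (V i x h) = sigma (ip y x) h.

Definition Vtilde (i : 'I_2) : K i -> H := tilde (V i).

Definition Vtilde12 : ts_12 K -> H :=
  fun u => Vtilde (id_tens (K 0) (@Vtilde 1) u).

Definition joint_defect (h : H) : H :=
  h - Vtilde (adj (@Vtilde 0) h) - Vtilde (adj (@Vtilde 1) h)
    + Vtilde12 (adj Vtilde12 h).

Definition wandering (i : 'I_2) : set H := ortho (range (@Vtilde i)).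

(* E_i (x) W_j as a closed subspace of E_i (x) H *)
Definition tens_wandering (i j : 'I_2) : set (K i) :=
  cspan [set htens (K i) p.1 p.2 | p in [set p : E i * H | wandering j p.2]].

Definition fringe (i j : 'I_2) (u : K i) : H := proj (wandering j) (Vtilde u).

Definition fringe_adj (i j : 'I_2) : H -> K i :=
  adj_on (@tens_wandering i j) (wandering j) (@fringe i j).

End FringeOperators.

Arguments wandering {R A H E sigma K} V i.
Arguments tens_wandering {R A H E sigma K} V i j.
Arguments fringe {R A H E sigma K} V i j u.
Arguments fringe_adj {R A H E sigma K} V i j.

(* Main.v *)
Require Import Defs.
From mathcomp Require Import all_boot all_order all_algebra complex.
From mathcomp Require Import all_classical all_reals all_analysis.
From mathcomp Require Import finmap ring lra.
Import Order.TTheory GRing.Theory Num.Theory.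
Import numFieldNormedType.Exports.
(* From here on, [ortho] is the orthogonal complement in a Hilbert space, not
   orthogonality for a sesquilinear form. *)
Import Defs.
Set Implicit Arguments.
Unset Strict Implicit.
Unset Printing Implicit Defensive.
Local Open Scope classical_set_scope.
Local Open Scope ring_scope.
Local Open Scope complex_scope.

(** Write [V_i] for the operator [tilde (V i)] from [E_i (x) H] to [H]. As the
    representation is isometric, [V_i] is an isometry, so [V_i V_i^*] is the
    projection onto its range. The operator of the product correspondence has
    range [V_i (E_i (x) range V_j)], for both orders of the indices, and
    [E_i (x) H] is the orthogonal sum of [E_i (x) range V_j] and
    [N := E_i (x) W_j]. Hence the joint defect operator collapses to a
    difference [C = p - q] of two projections: [p] onto the wandering subspace
    [W_j], and [q] onto [V_i N] ([joint_defectE]).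

    The fringe operator is [p V_i] restricted to [N]. Its two defects are
    [p - p q p] on [W_j] and, up to the isometry [V_i], [q - q p q] on the range
    of [q]. These are [p C p] and [- q C q], hence compact when [C] is.
    Conversely [C^3 = (p - p q p) - (q - q p q)] ([proj_diff_cube]), so [C^3] is
    compact when both defects are; and for a self-adjoint [C] one has
    [|C z|^3 <= |z|^2 |C^3 z|] ([rnorm_cube_le]), so that [C] is then compact as
    well. Both directions transfer compactness by comparing oscillations on the
    unit ball ([precompact_dominated]), which avoids adjoints and ideals of
    compact operators; they are assembled in [compact_proj_diff].

    The operators of the theorem are given implicitly, by values on elementary
    tensors or by adjoint equations, so these equations have to be solved: by
    the projection theorem ([projection_exists]), the Riesz representation
    ([adjoint_exists]) and the extension of inner-product preserving maps from a
    total family ([bounded_ext_isometry]). The totality of the tensors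
    [(x (x) y) (x) h] relies on the automatic contractivity of representations
    of a C*-algebra ([rep_contraction]). *)

(** * Norms with real values *)

Section RealNorm.
Variable R : realType.

(** Norms have values in [R[i]], whose order is only partial. [cabs] and [rnorm]
    are the same numbers seen in the ordered field [R]; closed sets, limits and
    continuity are restated in terms of them. *)
Definition cabs (z : R[i]) : R := complex.Re `|z|.

Lemma cabsE z : `|z| = (cabs z)%:C.
Proof. by rewrite /cabs RRe_real. Qed.

Lemma cabs_ge0 z : 0 <= cabs z.
Proof. by rewrite -lecR -cabsE rmorph0 normr_ge0. Qed.

Lemma cabsN z : cabs (- z) = cabs z.
Proof. by rewrite /cabs normrN. Qed.

Lemma cabs_real (r : R) : 0 <= r -> cabs r%:C = r.
Proof. by move=> r0; rewrite /cabs ger0_norm // lecR. Qed.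

Lemma cabs_eq0 z : cabs z = 0 -> z = 0.
Proof. by move=> z0; apply/eqP; rewrite -normr_eq0 cabsE z0. Qed.

Lemma ler_cabsD z w : cabs (z + w) <= cabs z + cabs w.
Proof. by rewrite -lecR rmorphD /= -!cabsE ler_normD. Qed.

Lemma cabs0 : cabs 0 = 0. Proof. by rewrite /cabs normr0. Qed.

Lemma Re_le_cabs z : complex.Re z <= cabs z.
Proof.
have := normc_ge_Re z; rewrite cabsE lecR.
by apply: le_trans; exact: ler_norm.
Qed.

Lemma conj_mul z : Num.conj z * z = (cabs z ^+ 2)%:C.
Proof. by rewrite rmorphXn /= -cabsE normCKC. Qed.

Variable H : normedModType R[i].
Implicit Types (x y z : H) (M S : set H).

Definition rnorm x : R := complex.Re `|x|.

Lemma rnormE x : `|x| = (rnorm x)%:C.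
Proof. by rewrite /rnorm RRe_real. Qed.

Lemma rnorm_ge0 x : 0 <= rnorm x.
Proof. by rewrite -lecR -rnormE rmorph0 normr_ge0. Qed.

Lemma ler_rnormD x y : rnorm (x + y) <= rnorm x + rnorm y.
Proof. by rewrite -lecR rmorphD /= -!rnormE ler_normD. Qed.

Lemma rnormN x : rnorm (- x) = rnorm x.
Proof. by rewrite /rnorm normrN. Qed.

Lemma rnormBC x y : rnorm (x - y) = rnorm (y - x).
Proof. by rewrite -opprB rnormN. Qed.

Lemma ler_rnormB x y : rnorm (x - y) <= rnorm x + rnorm y.
Proof. by rewrite -(rnormN y) ler_rnormD. Qed.

Lemma ler_rnorm_dist z x y : rnorm (x - y) <= rnorm (x - z) + rnorm (z - y).
Proof. by apply: le_trans (ler_rnormD _ _); rewrite addrA subrK. Qed.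

Lemma rnormZ a x : rnorm (a *: x) = cabs a * rnorm x.
Proof. by apply: complexI; rewrite rmorphM /= -rnormE -cabsE normrZ -rnormE. Qed.

Lemma rnorm0 : rnorm 0 = 0. Proof. by rewrite /rnorm normr0. Qed.

Lemma rnorm_eq0 x : rnorm x = 0 -> x = 0.
Proof. by move=> x0; apply/eqP; rewrite -normr_eq0 rnormE x0. Qed.

Lemma rnorm_small x : (forall e, 0 < e -> rnorm x <= e) -> x = 0.
Proof.
move=> h; apply: rnorm_eq0; apply/eqP; rewrite eq_le rnorm_ge0 andbT.
by rewrite leNgt; apply/negP => x0; have := h _ (divr_gt0 x0 (ltr0n R 2)); lra.
Qed.

Lemma norm_le1 x : (`|x| <= 1) = (rnorm x <= 1).
Proof. by rewrite rnormE -[1 in LHS]/(1%:C) lecR. Qed.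

Lemma pos_complex (e : R[i]) : 0 < e -> exists2 r : R, 0 < r & e = r%:C.
Proof.
case: e => a b; rewrite ltcE /= => /andP[/eqP -> a0].
by exists a.
Qed.

Lemma ball_rnorm x (r : R) y : ball x r%:C y <-> rnorm (x - y) < r.
Proof. by rewrite -ball_normE /ball_ /= rnormE ltcR. Qed.

Lemma closure_rnormP M x : closure M x <->
  forall e, 0 < e -> exists2 y, M y & rnorm (x - y) < e.
Proof.
split=> hx.
  move=> e e0; have [|y [My /ball_rnorm xy]] := hx (ball x e%:C).
    by apply: nbhsx_ballx; rewrite /= ltcR.
  by exists y.
move=> B /nbhs_ballP[e /pos_complex[r r0 ->] eB].
by have [y My xy] := hx _ r0; exists y; split => //; apply/eB/ball_rnorm.
Qed.

Lemma closed_rnormP M : closed M <->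
  forall x, (forall e, 0 < e -> exists2 y, M y & rnorm (x - y) < e) -> M x.
Proof. by split=> h x hx; apply: h; apply/closure_rnormP. Qed.

Lemma closed_subspace_cspan S : closed_subspace (cspan S).
Proof.
split.
- by move=> X [[]].
- by move=> a x y hx hy X XP; have [_ hX _] := XP.1; apply: hX; [exact: hx|exact: hy].
- apply/closed_rnormP => x hx X XP; have [_ _ /closed_rnormP] := XP.1; apply=> e e0.
  by have [y hy xy] := hx _ e0; exists y => //; exact: hy.
Qed.

Lemma sub_cspan S x : S x -> cspan S x.
Proof. by move=> Sx; exact: sub_gen_smallest. Qed.

Lemma cspan_ind S (P : set H) : closed_subspace P -> S `<=` P -> cspan S `<=` P.
Proof. by move=> hP SP; apply: smallest_sub. Qed.

Section Subspace.
Variable M : set H.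
Hypothesis hM : closed_subspace M.
Lemma csub0 : M 0. Proof. by case: hM. Qed.
Lemma csubD x y : M x -> M y -> M (x + y).
Proof. by case: hM => _ h _ Mx My; rewrite -(scale1r x); exact: h. Qed.
Lemma csubZ a x : M x -> M (a *: x).
Proof. by case: hM => M0 h _ Mx; rewrite -(addr0 (_ *: _)); exact: h. Qed.
Lemma csubN x : M x -> M (- x).
Proof. by rewrite -scaleN1r; exact: csubZ. Qed.
Lemma csubB x y : M x -> M y -> M (x - y).
Proof. by move=> Mx /csubN; exact: csubD. Qed.
Lemma csub_lim x : (forall e, 0 < e -> exists2 y, M y & rnorm (x - y) < e) -> M x.
Proof. by case: hM => _ _ /closed_rnormP; apply. Qed.
End Subspace.

End RealNorm.

(** Completeness in the form used for the projection theorem, the extension of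
    isometries and quasi-inverses: each time, the approximate solutions [P e]
    of a problem get closer to each other as the tolerance [e] decreases. *)
Lemma shrinking_limit (R : realType) (H : completeNormedModType R[i])
    (P : R -> set H) :
  (forall e, 0 < e -> P e !=set0) ->
  (forall d e, 0 < d -> d <= e -> P d `<=` P e) ->
  (forall e, 0 < e -> exists2 d, 0 < d &
     forall x y, P d x -> P d y -> rnorm (x - y) < e) ->
  exists l, forall e, 0 < e -> exists2 d, 0 < d &
    forall x, P d x -> rnorm (x - l) < e.
Proof.
move=> P0 Pm Pc; pose F := filter_from [set e : R | 0 < e] P.
have FF : ProperFilter F.
  apply: filter_from_proper; last by move=> e /P0.
  apply: filter_from_filter; first by exists 1; exact: ltr01.
  move=> d e d0 e0; exists (Num.min d e); first by rewrite /= lt_min d0.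
  by move=> x hx; split; apply: Pm hx; rewrite ?lt_min ?d0 // ge_min lexx ?orbT.
have Fc : cauchy F.
  apply: cauchy_exP => e /pos_complex[r r0 ->].
  have [d d0 hd] := Pc _ r0; have [x Px] := P0 _ d0.
  by exists x, d => // y Py; apply/ball_rnorm; exact: hd.
have [l Fl] := (cvg_ex _).1 (cauchy_cvg _ Fc); exists l => e e0.
have [|d d0 hd] := Fl (ball l e%:C); first by apply: nbhsx_ballx; rewrite /= ltcR.
by exists d => // x /hd /ball_rnorm; rewrite rnormBC.
Qed.

Section Linear.
Variables (R : realType) (H K : normedModType R[i]) (T : H -> K).
Hypothesis linT : linear T.

Lemma linear_add x y : T (x + y) = T x + T y.
Proof. by have := linT 1 x y; rewrite !scale1r. Qed.
Lemma linear_zero : T 0 = 0.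
Proof. by have := linT (-1) 0 0; rewrite !scaleN1r !addNr. Qed.
Lemma linear_scale a x : T (a *: x) = a *: T x.
Proof. by have := linT a x 0; rewrite linear_zero !addr0. Qed.
Lemma linear_opp x : T (- x) = - T x.
Proof. by rewrite -scaleN1r linear_scale scaleN1r. Qed.
Lemma linear_sub x y : T (x - y) = T x - T y.
Proof. by rewrite linear_add linear_opp. Qed.

Lemma continuous_bounded : continuous T ->
  exists2 C, 0 < C & forall x, rnorm (T x) <= C * rnorm x.
Proof.
move=> /(_ 0) cT.
have /cT /nbhs_ballP[e /= /pos_complex[r r0 ->] h] : nbhs (T 0) (ball (T 0) 1%:C).
  by apply: nbhsx_ballx; rewrite /= ltcR.
(* Scaling [x] to norm [r / 2] brings it into the ball of radius [r], which
   [T] maps into the unit ball. *)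
exists (2 / r) => [|x]; first by rewrite divr_gt0.
have [x0|x0] := eqVneq (rnorm x) 0.
  by rewrite (rnorm_eq0 x0) linear_zero !rnorm0 mulr0.
have xp : 0 < rnorm x by rewrite lt_neqAle eq_sym x0 rnorm_ge0.
have cp : 0 < r / 2 / rnorm x by rewrite !divr_gt0.
have /ball_rnorm : ball (T 0) 1%:C (T ((r / 2 / rnorm x)%:C *: x)).
  apply: h; apply/ball_rnorm.
  rewrite sub0r rnormN rnormZ (cabs_real (ltW cp)) -mulrA mulVf // mulr1.
  by rewrite gtr_pMr // invf_lt1 // ltr1n.
rewrite linear_zero sub0r rnormN linear_scale rnormZ (cabs_real (ltW cp)).
move=> /ltW le1; rewrite -[leLHS](mulKf (lt0r_neq0 cp)).
have -> : 2 / r * rnorm x = (r / 2 / rnorm x)^-1 by rewrite !invfM !invrK; ring.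
by rewrite ler_piMr // invr_ge0 ltW.
Qed.

Lemma bounded_continuous C : (forall x, rnorm (T x) <= C * rnorm x) ->
  continuous T.
Proof.
move=> hC x B /nbhs_ballP[e /pos_complex[r r0 ->] hB].
have C1 : 0 < `|C| + 1 by rewrite ltr_pwDr.
apply/nbhs_ballP; exists (r / (`|C| + 1))%:C; first by rewrite /= ltcR divr_gt0.
move=> y /ball_rnorm xy; apply/hB/ball_rnorm; rewrite -linear_sub.
apply: le_lt_trans (hC _) _; move: xy; rewrite ltr_pdivlMr //.
apply: le_lt_trans; rewrite mulrC ler_wpM2l ?rnorm_ge0 //.
by rewrite ler_wpDr ?ler_norm.
Qed.

Lemma continuous_bound_op C : (forall x, rnorm (T x) <= C * rnorm x) ->
  bounded_op T.
Proof. by move=> hC; split=> //; exact: bounded_continuous hC. Qed.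

End Linear.

(** * Compactness through finite covers by small sets *)

Section Precompact.
Variable R : realType.

(** Total boundedness of the image of [B], stated by a finite cover of the
    domain [B]: in this form covers can be intersected and pulled back without
    choosing centres. *)
Definition precompact_on (X : Type) (K : normedModType R[i]) (B : set X)
    (T : X -> K) : Prop :=
  forall e : R, 0 < e -> exists s : seq (set X),
    (forall x, B x -> exists2 A, A \in s & A x) /\
    (forall A, A \in s -> forall x y, A x -> A y -> rnorm (T x - T y) < e).

Lemma compact_precompact X (K : normedModType R[i]) (B : set X) (T : X -> K) :
  compact (closure (T @` B)) -> precompact_on B T.
Proof.
rewrite compact_cover => cT e e0.
have e2 : 0 < e / 2 by rewrite divr_gt0.
have [|y By|D' _ hD'] := cT K setT (fun y : K => ball y (e / 2)%:C).
- by move=> y _; apply: ball_open; rewrite ltcR.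
- by exists y => //; apply: ballxx; rewrite ltcR.
exists [seq T @^-1` ball y (e / 2)%:C | y <- D']; split.
  move=> x Bx; have [|y /= yD' yx] := hD' (T x).
    by apply: subset_closure; exists x.
  by exists (T @^-1` ball y (e / 2)%:C) => //; apply/mapP; exists y.
move=> _ /mapP[y _ ->] x x' /ball_rnorm yx /ball_rnorm yx'.
apply: le_lt_trans (ler_rnorm_dist y _ _) _.
by rewrite (rnormBC _ y) (splitr e) ltrD.
Qed.

(** An ultrafilter on the closure of the image contains the closure of one of
    the finitely many small pieces, at every scale; so it is Cauchy. *)
Lemma precompact_compact X (K : completeNormedModType R[i]) (B : set X)
    (T : X -> K) :
  precompact_on B T -> compact (closure (T @` B)).
Proof.
move=> pT; rewrite compact_ultra => F FU FB.
have cover (s : seq (set X)) : (forall x, B x -> exists2 A, A \in s & A x) ->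
    exists2 A, A \in s & F (closure (T @` A)).
  move=> hs; have : F (closure [set y | exists2 A, A \in s & (T @` A) y]).
    apply: filterS FB; apply: closureS => _ [x Bx <-].
    by have [A As Ax] := hs x Bx; exists A => //; exists x.
  elim: s {hs} => [|A s IH].
    rewrite (_ : [set y | _] = set0) ?closure0; last first.
      by rewrite -subset0 => y [].
    by move/filter_ex => -[].
  rewrite (_ : [set y | _] =
      T @` A `|` [set y | exists2 A, A \in s & (T @` A) y]); last first.
    apply/seteqP; split=> y.
      move=> [A']; rewrite inE => /orP[/eqP -> ?|A's ?]; first by left.
      by right; exists A'.
    move=> [?|[A' A's ?]]; first by exists A => //; rewrite mem_head.
    by exists A' => //; rewrite inE A's orbT.
  rewrite closureU => FAs.
  have [FA|FnA] := in_ultra_setVsetC (closure (T @` A)) FU.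
    by exists A; rewrite ?mem_head.
  have [|A' A's FA'] := IH; last by exists A'; rewrite // inE A's orbT.
  by apply: filterS (filterI FAs FnA) => y [[]].
have Fc : cauchy F.
  apply: cauchy_exP => e /pos_complex[r r0 ->].
  have r4 : 0 < r / 4 by rewrite divr_gt0.
  have [s [/cover[A As FA] hs]] := pT _ r4.
  have [y Ay] := filter_ex FA; exists y; apply: filterS FA => z Az.
  have [_ [x Ax <-] yx] := (closure_rnormP _ _).1 Ay _ r4.
  have [_ [x' Ax' <-] zx'] := (closure_rnormP _ _).1 Az _ r4.
  apply/ball_rnorm; have := hs _ As _ _ Ax Ax'.
  have := ler_rnorm_dist (T x) y z; have := ler_rnorm_dist (T x') (T x) z.
  move: yx zx'; rewrite (rnormBC z); lra.
have [l Fl] := (cvg_ex _).1 (cauchy_cvg _ Fc); exists l; split=> //.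
by apply: (closed_cvg _ (@closed_closure _ _) FB); exact: Fl.
Qed.

(** When two precompact maps control the oscillation of [T] on [B], the
    intersections of their small covers form a small cover for [T]. This
    replaces sums, products and adjoints of compact operators. *)
Lemma precompact_dominated X (K1 K2 K : normedModType R[i]) (B : set X)
    (T1 : X -> K1) (T2 : X -> K2) (T : X -> K) :
  precompact_on B T1 -> precompact_on B T2 ->
  (forall e, 0 < e -> exists2 d, 0 < d & forall x y, B x -> B y ->
     rnorm (T1 x - T1 y) < d -> rnorm (T2 x - T2 y) < d ->
     rnorm (T x - T y) < e) ->
  precompact_on B T.
Proof.
move=> pT1 pT2 hT e /hT[d d0 hd].
have [s1 [c1 h1]] := pT1 _ d0; have [s2 [c2 h2]] := pT2 _ d0.
exists [seq A1 `&` A2 `&` B | A1 <- s1, A2 <- s2]; split.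
  move=> x Bx; have [A1 A1s A1x] := c1 _ Bx; have [A2 A2s A2x] := c2 _ Bx.
  exists (A1 `&` A2 `&` B) => //.
  by apply/allpairsP; exists (A1, A2).
move=> _ /allpairsP[[A1 A2] /= [A1s A2s ->]] x y [[? ?] ?] [[? ?] ?].
by apply: hd => //; [exact: (h1 A1)|exact: (h2 A2)].
Qed.

Lemma precompact_comp X Y (K : normedModType R[i]) (B : set X) (B' : set Y)
    (f : X -> Y) (T : Y -> K) :
  (forall x, B x -> B' (f x)) -> precompact_on B' T -> precompact_on B (T \o f).
Proof.
move=> fB pT e /pT[s [cs hs]]; exists [seq f @^-1` A | A <- s]; split.
  move=> x /fB/cs[A As Ax]; exists (f @^-1` A) => //.
  by apply/mapP; exists A.
by move=> _ /mapP[A As ->] x y; exact: hs.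
Qed.

End Precompact.

Lemma compact_op_onP (R : realType) (H K : hilbertType R) (M : set H) (T : H -> K) :
  compact_op_on M T <-> precompact_on [set x | M x /\ rnorm x <= 1] T.
Proof.
have E : [set x | M x /\ `|x| <= 1] = [set x | M x /\ rnorm x <= 1].
  by apply/seteqP; split=> x /= [Mx]; rewrite norm_le1.
rewrite /compact_op_on E.
by split=> [/compact_precompact|/precompact_compact].
Qed.

Lemma eq_compact_op_on (R : realType) (H K : hilbertType R) (M : set H) (S T : H -> K) :
  (forall x, M x -> S x = T x) -> compact_op_on M S <-> compact_op_on M T.
Proof.
move=> ST; rewrite /compact_op_on.
by rewrite (_ : S @` _ = T @` [set x | M x /\ `|x| <= 1]) //; apply: eq_imagel => x [/ST].
Qed.

(** * Bounded operators and closed subspaces *)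

Section BoundedOperators.
Variable R : realType.
Implicit Types H K L : normedModType R[i].

Lemma bounded_opP H K (T : H -> K) : bounded_op T <->
  linear T /\ exists2 C, 0 < C & forall x, rnorm (T x) <= C * rnorm x.
Proof.
split=> [[lT cT]|[lT [C _ hC]]]; first by split=> //; exact: continuous_bounded.
exact: continuous_bound_op hC.
Qed.

Lemma bounded_op_comp H K L (S : K -> L) (T : H -> K) :
  bounded_op S -> bounded_op T -> bounded_op (S \o T).
Proof.
move=> /bounded_opP[lS [C C0 hC]] /bounded_opP[lT [D D0 hD]]; apply/bounded_opP.
split=> [a x y|]; first by rewrite /= lT lS.
exists (C * D) => [|x /=]; first by rewrite mulr_gt0.
by apply: le_trans (hC _) _; rewrite -mulrA ler_pM2l.
Qed.

Lemma closed_subspace_preimage H K (T : H -> K) (M : set K) :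
  bounded_op T -> closed_subspace M -> closed_subspace (T @^-1` M).
Proof.
move=> /bounded_opP[lT [C C0 hC]] hM; split.
- by rewrite /preimage /= (linear_zero lT); exact: csub0.
- move=> a x y Mx My; rewrite /preimage /= lT.
  by apply: csubD => //; exact: csubZ.
- apply/closed_rnormP => x hx; apply: (csub_lim hM) => e e0.
  have [y My xy] := hx _ (divr_gt0 e0 C0); exists (T y) => //.
  rewrite -(linear_sub lT); apply: le_lt_trans (hC _) _.
  by rewrite mulrC -ltr_pdivlMr.
Qed.

Lemma closed_subspace_zero H : closed_subspace [set 0 : H].
Proof.
split=> //; first by move=> a x y -> ->; rewrite scaler0 addr0.
apply/closed_rnormP => x hx; apply: rnorm_small => e /hx[_ ->].
by rewrite subr0 => /ltW.
Qed.

Lemma closed_subspace_setT H : closed_subspace [set: H].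
Proof. by split=> //; exact: closedT. Qed.

Lemma closed_subspace_bigcap H (I : Type) (D : set I) (M : I -> set H) :
  (forall i, D i -> closed_subspace (M i)) ->
  closed_subspace [set x | forall i, D i -> M i x].
Proof.
move=> hM; split.
- by move=> i /hM[].
- by move=> a x y hx hy i Di; have [_ h _] := hM i Di; apply: h; [exact: hx|exact: hy].
- apply/closed_rnormP => x hx i Di; apply: (csub_lim (hM _ Di)) => e /hx[y hy xy].
  by exists y => //; exact: hy.
Qed.

Lemma bounded_op_sub H K (S T : H -> K) :
  bounded_op S -> bounded_op T -> bounded_op (fun x => S x - T x).
Proof.
move=> /bounded_opP[lS [C C0 hC]] /bounded_opP[lT [D D0 hD]]; apply/bounded_opP.
split=> [a x y|]; first by rewrite lT lS scalerBr opprD addrACA.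
exists (C + D) => [|x]; first by rewrite addr_gt0.
by apply: le_trans (ler_rnormB _ _) _; rewrite mulrDl lerD.
Qed.

Lemma closed_subspace_equalizer H K (S T : H -> K) :
  bounded_op S -> bounded_op T -> closed_subspace [set x | S x = T x].
Proof.
move=> hS hT.
have := closed_subspace_preimage (bounded_op_sub hS hT) (@closed_subspace_zero K).
congr closed_subspace; apply/seteqP; split=> x /=; rewrite /preimage /=.
  by move/eqP; rewrite subr_eq0 => /eqP.
by move=> ->; rewrite subrr.
Qed.

Lemma eq_on_total H K (Y : Type) (g : Y -> H) (D : set Y) (S T : H -> K) :
  bounded_op S -> bounded_op T -> cspan [set g p | p in D] = setT ->
  (forall p, D p -> S (g p) = T (g p)) -> S =1 T.
Proof.
move=> hS hT tot hg x.
have : cspan [set g p | p in D] x by rewrite tot.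
apply: (cspan_ind (P := [set x | S x = T x])).
  exact: closed_subspace_equalizer.
by move=> _ [p Dp <-]; exact: hg.
Qed.

End BoundedOperators.

(** * Hilbert spaces *)

Section Hilbert.
Variable R : realType.
Variable H : hilbertType R.
Implicit Types (x y z : H) (M N S : set H).

Lemma dotDr x y z : dot x (y + z) = dot x y + dot x z.
Proof. by have := dot_linear x 1 y z; rewrite scale1r mul1r. Qed.
Lemma dot0r x : dot x 0 = 0.
Proof. by have := dot_linear x (-1) 0 0; rewrite scaleN1r addNr mulN1r addNr. Qed.
Lemma dotZr a x y : dot x (a *: y) = a * dot x y.
Proof. by have := dot_linear x a y 0; rewrite dot0r !addr0. Qed.
Lemma dotNr x y : dot x (- y) = - dot x y.
Proof. by rewrite -scaleN1r dotZr mulN1r. Qed.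
Lemma dotBr x y z : dot x (y - z) = dot x y - dot x z.
Proof. by rewrite dotDr dotNr. Qed.
Lemma dotDl x y z : dot (x + y) z = dot x z + dot y z.
Proof. by rewrite dot_conj dotDr rmorphD /= -!dot_conj. Qed.
Lemma dot0l x : dot 0 x = 0.
Proof. by rewrite dot_conj dot0r rmorph0. Qed.
Lemma dotZl a x y : dot (a *: x) y = Num.conj a * dot x y.
Proof. by rewrite dot_conj dotZr rmorphM /= -dot_conj. Qed.
Lemma dotNl x y : dot (- x) y = - dot x y.
Proof. by rewrite dot_conj dotNr rmorphN /= -dot_conj. Qed.
Lemma dotBl x y z : dot (x - y) z = dot x z - dot y z.
Proof. by rewrite dotDl dotNl. Qed.

Lemma dotxx x : dot x x = (rnorm x ^+ 2)%:C.
Proof. by rewrite -dot_norm rnormE rmorphXn. Qed.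

Lemma dotxx_eq0 x : dot x x = 0 -> x = 0.
Proof.
rewrite dotxx => /(congr1 (@complex.Re _)) /= /eqP.
by rewrite sqrf_eq0 => /eqP /rnorm_eq0.
Qed.

Lemma dot_inj x y : (forall z, dot z x = dot z y) -> x = y.
Proof.
move=> h; apply/eqP; rewrite -subr_eq0; apply/eqP/dotxx_eq0.
by rewrite dotBr h subrr.
Qed.

Lemma Re_dotC x y : complex.Re (dot y x) = complex.Re (dot x y).
Proof. by rewrite (dot_conj x y); case: (dot x y). Qed.

Lemma rnormD_sqr x y :
  rnorm (x + y) ^+ 2 = rnorm x ^+ 2 + 2 * complex.Re (dot x y) + rnorm y ^+ 2.
Proof.
have E z : rnorm z ^+ 2 = complex.Re (dot z z) by rewrite dotxx.
rewrite !E dotDl !dotDr !raddfD /= (Re_dotC x y) -!E; ring.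
Qed.

Lemma rnormB_sqr x y :
  rnorm (x - y) ^+ 2 = rnorm x ^+ 2 - 2 * complex.Re (dot x y) + rnorm y ^+ 2.
Proof. rewrite rnormD_sqr rnormN dotNr raddfN /=; ring. Qed.

Lemma parallelogram x y : rnorm (x + y) ^+ 2 + rnorm (x - y) ^+ 2 =
  2 * (rnorm x ^+ 2 + rnorm y ^+ 2).
Proof. rewrite rnormD_sqr rnormB_sqr; ring. Qed.

(** Pythagoras for the component of [y] orthogonal to [x]; it gives both the
    Cauchy-Schwarz inequality and the orthogonality of the nearest point. *)
Lemma rnorm_sub_component x y : x != 0 ->
  rnorm (y - (dot x y / dot x x) *: x) ^+ 2 =
  rnorm y ^+ 2 - cabs (dot x y) ^+ 2 / rnorm x ^+ 2.
Proof.
move=> x0; have nx : dot x x != 0 by apply: contraNneq x0 => /dotxx_eq0 ->.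
apply: complexI; rewrite rmorphB fmorph_div /= -!dotxx -conj_mul.
have cx : Num.conj (dot x x) = dot x x by rewrite -dot_conj.
rewrite dotBl !dotBr !dotZl !dotZr rmorphM fmorphV /= cx (dot_conj x y).
by field.
Qed.

Lemma cauchy_schwarz x y : cabs (dot x y) <= rnorm x * rnorm y.
Proof.
have [->|x0] := eqVneq x 0; first by rewrite dot0l cabs0 rnorm0 mul0r.
have nx : 0 < rnorm x.
  by rewrite lt_neqAle rnorm_ge0 andbT eq_sym; apply: contraNneq x0 => /rnorm_eq0 ->.
have := sqr_ge0 (rnorm (y - (dot x y / dot x x) *: x)).
rewrite rnorm_sub_component // subr_ge0 ler_pdivrMr ?exprn_gt0 // -exprMn.
by rewrite ler_sqr ?nnegrE ?cabs_ge0 ?mulr_ge0 ?rnorm_ge0 // mulrC.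
Qed.

Lemma Re_dot_le x y : complex.Re (dot x y) <= rnorm x * rnorm y.
Proof. exact: le_trans (Re_le_cabs _) (cauchy_schwarz _ _). Qed.

Lemma bounded_dot x : bounded_op (dot x : H -> R[i]^o).
Proof.
apply/bounded_opP; split; first by move=> a y z; exact: dot_linear.
exists (rnorm x + 1) => [|y]; first by rewrite ltr_wpDl ?rnorm_ge0.
apply: le_trans (cauchy_schwarz _ _) _.
by rewrite ler_wpM2r ?rnorm_ge0 // lerDl ler01.
Qed.

Lemma closed_subspace_ortho S : closed_subspace (ortho S).
Proof.
apply: (@closed_subspace_bigcap _ _ _ S (fun y => [set x | dot y x = 0])) => y _.
exact: (closed_subspace_preimage (bounded_dot y) (@closed_subspace_zero _ R[i]^o)).
Qed.

Lemma orthoC S x y : S y -> ortho S x -> dot x y = 0.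
Proof. by move=> Sy /(_ _ Sy) yx; rewrite dot_conj yx rmorph0. Qed.

Lemma ortho_cspan S x : ortho S x -> ortho (cspan S) x.
Proof.
move=> Sx y; have : closed_subspace (ortho [set x]) by exact: closed_subspace_ortho.
move/cspan_ind => /(_ S) h Sy; rewrite dot_conj (h _ y) ?rmorph0 // => z Sz _ ->.
exact: orthoC Sx.
Qed.

Section Projection.
Variable M : set H.
Hypothesis hM : closed_subspace M.

(** By the parallelogram law, near-minimizers of the distance from [x] to [M]
    are close to each other, hence they converge to a nearest point [l]; and
    [x - l] is orthogonal to [M], for otherwise moving [l] along [M] would
    decrease the distance. *)
Lemma projection_exists x : exists y, M y /\ ortho M (x - y).
Proof.
pose D := [set rnorm (x - y) ^+ 2 | y in M].
have iD : has_inf D.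
  split; first by exists (rnorm (x - 0) ^+ 2), 0 => //; exact: csub0.
  by exists 0 => _ [y _ <-]; exact: sqr_ge0.
pose d := inf D.
have d_le y : M y -> d <= rnorm (x - y) ^+ 2.
  by move=> My; apply: ge_inf; [case: iD|exists y].
pose P e := [set y | M y /\ rnorm (x - y) ^+ 2 < d + e].
have [||e e0|l hl] := @shrinking_limit R H P.
- move=> e e0; have [_ [y My <-] ye] := inf_adherent e0 iD.
  by exists y.
- move=> a b a0 ab y [My h]; split=> //; apply: lt_le_trans h _.
  by rewrite lerD2l.
- exists (e ^+ 2 / 4) => [|y z [My hy] [Mz hz]].
    by rewrite divr_gt0 // exprn_gt0.
  have Mm : M (2^-1 *: (y + z)) by apply: csubZ => //; exact: csubD.
  have := parallelogram (x - y) (x - z).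
  have -> : x - y + (x - z) = 2 *: (x - 2^-1 *: (y + z)).
    rewrite scalerBr scalerA divff ?pnatr_eq0 // scale1r scaler_nat.
    by rewrite mulr2n addrACA opprD.
  have -> : x - y - (x - z) = z - y by rewrite opprB addrC subrKA.
  rewrite rnormZ exprMn.
  have -> : cabs (2 : R[i]) = 2.
    by rewrite -(rmorph_nat (@real_complex R)) cabs_real // ler0n.
  have := d_le _ Mm; rewrite rnormBC => hd hp.
  rewrite -ltr_sqr ?nnegrE ?rnorm_ge0 ?ltW //.
  rewrite rnormBC; lra.
have Ml : M l.
  apply: (csub_lim hM) => e e0; have [a a0 ha] := hl _ e0.
  have [_ [y My <-] ye] := inf_adherent a0 iD.
  by exists y => //; rewrite rnormBC; exact: ha.
exists l; split=> // m Mm.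
have [->|m0] := eqVneq m 0; first by rewrite dot0l.
set z := x - l; apply: cabs_eq0.
have zd : rnorm z ^+ 2 <= d.
  have d0 : 0 <= d.
    by apply: lb_le_inf; [case: iD|move=> _ [y _ <-]; exact: sqr_ge0].
  rewrite leNgt; apply/negP => dz; have z0 := rnorm_ge0 z.
  (* A near-minimizer within [e] of the limit gives [(|z| - e)^2 < d + e]; this
     fails for the [e] with [e (2 |z| + 2) = |z|^2 - d]. *)
  pose e := (rnorm z ^+ 2 - d) / (2 * rnorm z + 2).
  have D0 : 0 < 2 * rnorm z + 2 by lra.
  have eE : e * (2 * rnorm z + 2) = rnorm z ^+ 2 - d by rewrite divfK ?lt0r_neq0.
  have e0 : 0 < e by rewrite divr_gt0 // subr_gt0.
  have [a a0 ha] := hl _ e0.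
  have mp : 0 < Num.min a e by rewrite lt_min a0.
  have [_ [y My <-] ye] := inf_adherent mp iD.
  have ya : rnorm (x - y) ^+ 2 < d + a.
    by apply: lt_le_trans ye _; rewrite lerD2l ge_min lexx.
  have {}ye : rnorm (x - y) ^+ 2 < d + e.
    by apply: lt_le_trans ye _; rewrite lerD2l ge_min lexx orbT.
  have zl := ler_rnorm_dist y x l; have yl := ha y (conj My ya).
  rewrite -/z in zl; have xy0 := rnorm_ge0 (x - y).
  have eN : 0 <= rnorm z - e.
    by rewrite subr_ge0 leNgt; apply/negP => Ne; nra.
  have : (rnorm z - e) ^+ 2 <= rnorm (x - y) ^+ 2.
    by rewrite ler_sqr ?nnegrE //; lra.
  by nra.
have Ml' : M (l + (dot m z / dot m m) *: m) by apply: csubD => //; exact: csubZ.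
have := d_le _ Ml'; rewrite opprD addrA -/z rnorm_sub_component // => dz.
have m2 : 0 < rnorm m ^+ 2.
  rewrite exprn_gt0 // lt_neqAle rnorm_ge0 andbT eq_sym.
  by apply: contraNneq m0 => /rnorm_eq0 ->.
have : cabs (dot m z) ^+ 2 / rnorm m ^+ 2 <= 0 by lra.
rewrite pmulr_lle0 ?invr_gt0 // => c0; apply/eqP.
by rewrite -sqrf_eq0 eq_le c0 sqr_ge0.
Qed.
End Projection.
End Hilbert.

(** * Orthogonal projections, adjoints and isometries *)

Section ProjectionOperator.
Variables (R : realType) (H : hilbertType R) (M : set H).
Hypothesis hM : closed_subspace M.
Implicit Types x y : H.

Lemma projP x : M (proj M x) /\ ortho M (x - proj M x).
Proof. by have := xgetPex 0 (projection_exists hM x). Qed.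

Lemma proj_in x : M (proj M x). Proof. exact: (projP x).1. Qed.
Lemma proj_ortho x : ortho M (x - proj M x). Proof. exact: (projP x).2. Qed.

Lemma proj_unique x y : M y -> ortho M (x - y) -> proj M x = y.
Proof.
move=> My xy; apply/eqP; rewrite -subr_eq0; apply/eqP/dotxx_eq0.
have Mpy : M (proj M x - y) by apply: csubB => //; exact: proj_in.
have -> : dot (proj M x - y) (proj M x - y) =
    dot (proj M x - y) (x - y) - dot (proj M x - y) (x - proj M x).
  by rewrite -dotBr; congr dot; rewrite opprB [RHS]addrC subrKA.
by rewrite xy // proj_ortho // subrr.
Qed.

Lemma proj_id x : M x -> proj M x = x.
Proof. by move=> Mx; apply: proj_unique => // y _; rewrite subrr dot0r. Qed.

Lemma proj_linear : linear (proj M).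
Proof.
move=> a x y; apply: proj_unique.
  by apply: (csubD hM); [apply: (csubZ hM)|]; exact: proj_in.
rewrite opprD addrACA -scalerBr.
have hO := closed_subspace_ortho M.
by apply: (csubD hO); [apply: (csubZ hO)|]; exact: proj_ortho.
Qed.

Lemma dot_proj x y : dot (proj M x) y = dot x (proj M y).
Proof.
have h z w : dot (proj M z) w = dot (proj M z) (proj M w).
  apply/eqP; rewrite -subr_eq0 -dotBr; apply/eqP; apply: proj_ortho.
  exact: proj_in.
by rewrite h dot_conj -h -dot_conj.
Qed.

Lemma rnorm_proj_le x : rnorm (proj M x) <= rnorm x.
Proof.
have := Re_dot_le (proj M x) x.
have -> : dot (proj M x) x = dot (proj M x) (proj M x).
  apply/eqP; rewrite -subr_eq0 -dotBr; apply/eqP; apply: proj_ortho.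
  exact: proj_in.
rewrite dotxx /=; have [->|h] := eqVneq (rnorm (proj M x)) 0; first by rewrite rnorm_ge0.
by rewrite expr2 ler_pM2l // lt_neqAle eq_sym h rnorm_ge0.
Qed.

Lemma bounded_proj : bounded_op (proj M).
Proof.
apply/bounded_opP; split; first exact: proj_linear.
by exists 1 => // x; rewrite mul1r rnorm_proj_le.
Qed.

Lemma ortho_ortho : ortho (ortho M) = M.
Proof.
apply/seteqP; split=> x hx; last by move=> y; exact: orthoC.
suff -> : x = proj M x by exact: proj_in.
apply/eqP; rewrite -subr_eq0; apply/eqP/dotxx_eq0.
rewrite dotBr hx; last exact: proj_ortho.
by rewrite sub0r (orthoC (proj_in x)) ?oppr0 //; exact: proj_ortho.
Qed.

End ProjectionOperator.

Lemma proj_orthoE (R : realType) (H : hilbertType R) (M : set H) x :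
  closed_subspace M -> proj (ortho M) x = x - proj M x.
Proof.
move=> hM; apply: (proj_unique (closed_subspace_ortho M)).
  exact: proj_ortho.
by rewrite opprB addrC subrK ortho_ortho //; exact: proj_in.
Qed.

Section Adjoint.
Variable R : realType.
Implicit Types H K : hilbertType R.

(** The Riesz representation of [x |-> dot y (T x)]: a vector [w] orthogonal to
    the kernel of this functional, suitably scaled, represents it. *)
Lemma adjoint_exists H K (T : H -> K) : bounded_op T ->
  exists S : K -> H, forall x y, dot (T x) y = dot x (S y).
Proof.
move=> bT; suff : forall y, exists z, forall x, dot (T x) y = dot x z.
  by move=> /choice[S hS]; exists S.
move=> y; pose f x : R[i]^o := dot y (T x).
have bf : bounded_op f := bounded_op_comp (bounded_dot y) bT.
have lf : linear f by case: bf.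
pose M := f @^-1` [set 0].
have hM : closed_subspace M :=
  closed_subspace_preimage bf (@closed_subspace_zero _ R[i]^o).
have fE z : (forall x, f x = dot z x) -> exists z, forall x, dot (T x) y = dot x z.
  by move=> h; exists z => x; rewrite dot_conj [dot y _]h -dot_conj.
have [MT|] := pselect (forall x, M x).
  by apply: (fE 0) => x; rewrite dot0l; exact: MT.
move=> /existsNP[x0 nMx0]; pose w := x0 - proj M x0.
have fw : f w != 0.
  apply: contra_not_neq nMx0 => fw0; have : M (w + proj M x0).
    by apply: csubD => //; exact: proj_in.
  by rewrite subrK.
have w0 : dot w w != 0.
  by apply: contraNneq fw => /dotxx_eq0 ->; rewrite (linear_zero lf).
apply: (fE ((Num.conj (f w) / dot w w) *: w)) => x.
rewrite dotZl rmorphM fmorphV /= -dot_conj conjCK.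
have : dot (f w *: x - f x *: w) w = 0.
  apply: (proj_ortho hM); rewrite /M /preimage /= (linear_sub lf) !(linear_scale lf).
  by rewrite [f w *: _]mulrC subrr.
rewrite dotBl !dotZl => /eqP; rewrite subr_eq0 => /eqP /(congr1 Num.conj).
rewrite !rmorphM /= !conjCK -!dot_conj => h.
by rewrite mulrAC h mulfK.
Qed.

Lemma adj_onE H K (M : set H) (N : set K) (T : H -> K) (S : K -> H) :
  closed_subspace M ->
  (forall y, N y -> M (S y) /\ forall x, M x -> dot (T x) y = dot x (S y)) ->
  forall y, N y -> adj_on M N T y = S y.
Proof.
move=> hM hS y Ny; have [Ma ha] : M (adj_on M N T y) /\
    forall x, M x -> dot (T x) y = dot x (adj_on M N T y).
  rewrite /adj_on; case: xgetP => [_ -> /(_ _ Ny)//|].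
  by move=> /(_ S) /(_ hS).
have [Ms hs] := hS _ Ny.
apply/eqP; rewrite -subr_eq0; apply/eqP/dotxx_eq0.
have Md : M (adj_on M N T y - S y) by exact: csubB.
by rewrite dotBr -ha // -hs // subrr.
Qed.

Lemma dot_adj H K (T : H -> K) : bounded_op T ->
  forall x y, dot (T x) y = dot x (adj T y).
Proof.
move=> /adjoint_exists[S hS] x y.
by rewrite /adj (adj_onE (@closed_subspace_setT _ _) (S := S)).
Qed.

End Adjoint.

Section Isometry.
Variables (R : realType) (H K : hilbertType R) (T : H -> K).

Definition isometry : Prop := linear T /\ forall x y, dot (T x) (T y) = dot x y.

Hypothesis iT : isometry.

Lemma isometry_linear : linear T. Proof. by case: iT. Qed.
Lemma isometry_dot x y : dot (T x) (T y) = dot x y. Proof. by case: iT. Qed.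

Lemma rnorm_isometry x : rnorm (T x) = rnorm x.
Proof.
apply/eqP; rewrite -(@eqrXn2 _ 2) ?rnorm_ge0 //; apply/eqP/complexI.
by rewrite -!dotxx isometry_dot.
Qed.

Lemma isometry_bounded : bounded_op T.
Proof.
apply/bounded_opP; split; first exact: isometry_linear.
by exists 1 => // x; rewrite mul1r rnorm_isometry.
Qed.

Let dot_adjT x y : dot (T x) y = dot x (adj T y) := dot_adj isometry_bounded x y.

Lemma isometryK x : adj T (T x) = x.
Proof. by apply: dot_inj => z; rewrite -dot_adjT isometry_dot. Qed.

Lemma adj_linear : linear (adj T).
Proof.
move=> a x y; apply: dot_inj => z.
by rewrite -dot_adjT dot_linear !dot_adjT -dot_linear.
Qed.

Lemma rnorm_adj_le y : rnorm (adj T y) <= rnorm y.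
Proof.
have := Re_dot_le (T (adj T y)) y; rewrite dot_adjT dotxx /= rnorm_isometry.
have [->|h] := eqVneq (rnorm (adj T y)) 0; first by rewrite rnorm_ge0.
by rewrite expr2 ler_pM2l // lt_neqAle eq_sym h rnorm_ge0.
Qed.

Lemma adj_bounded : bounded_op (adj T).
Proof.
apply/bounded_opP; split; first exact: adj_linear.
by exists 1 => // x; rewrite mul1r rnorm_adj_le.
Qed.

(** Describes an image by equations between bounded operators, from which its
    closedness follows. *)
Lemma isometry_image (M : set H) :
  T @` M = [set y | T (adj T y) = y /\ M (adj T y)].
Proof.
apply/seteqP; split=> [_ [x Mx <-]|y [yE My]]; first by rewrite /= isometryK.
by exists (adj T y).
Qed.

Lemma closed_subspace_image (M : set H) :
  closed_subspace M -> closed_subspace (T @` M).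
Proof.
move=> hM; rewrite isometry_image.
have h1 : closed_subspace [set y | (T \o adj T) y = id y].
  apply: closed_subspace_equalizer.
    exact: bounded_op_comp isometry_bounded adj_bounded.
  by apply/bounded_opP; split=> //; exists 1 => // x; rewrite mul1r.
have h2 : closed_subspace (adj T @^-1` M).
  exact: closed_subspace_preimage adj_bounded hM.
split; first by split; exact: (csub0 h1) || exact: (csub0 h2).
- move=> a x y [x1 x2] [y1 y2]; split.
    by apply: (csubD h1) => //; exact: (csubZ h1).
  by apply: (csubD h2) => //; exact: (csubZ h2).
- apply/closed_rnormP => x hx; split.
    by apply: (csub_lim h1) => e /hx[y [? ?] ?]; exists y.
  by apply: (csub_lim h2) => e /hx[y [? ?] ?]; exists y.
Qed.

Lemma closed_subspace_range : closed_subspace (range T).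
Proof. exact: closed_subspace_image (@closed_subspace_setT _ _). Qed.

Lemma proj_image (M : set H) y : closed_subspace M ->
  proj (T @` M) y = T (proj M (adj T y)).
Proof.
move=> hM; apply: (proj_unique (closed_subspace_image hM)).
  by exists (proj M (adj T y)) => //; exact: proj_in.
move=> _ [x Mx <-]; rewrite dotBr dot_adjT isometry_dot -dotBr.
exact: proj_ortho.
Qed.

Lemma proj_range y : proj (range T) y = T (adj T y).
Proof.
rewrite proj_image; last exact: closed_subspace_setT.
by rewrite proj_id //; exact: closed_subspace_setT.
Qed.

End Isometry.

Lemma isometry_comp (R : realType) (H1 H2 H3 : hilbertType R)
    (S : H2 -> H3) (T : H1 -> H2) :
  isometry S -> isometry T -> isometry (S \o T).
Proof.
move=> [lS dS] [lT dT]; split=> [a x y|x y] /=; first by rewrite lT lS.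
by rewrite dS dT.
Qed.

(** * Operators given on a total family *)

Lemma total_dot_inj (R : realType) (H : hilbertType R) (S : set H) (u v : H) :
  cspan S = setT -> (forall x, S x -> dot x u = dot x v) -> u = v.
Proof.
move=> tot h; apply/eqP; rewrite -subr_eq0; apply/eqP/dotxx_eq0.
have : ortho (cspan S) (u - v).
  by apply: ortho_cspan => x Sx; rewrite dotBr h // subrr.
by apply; rewrite tot.
Qed.

Section IsometricExtension.
Variables (R : realType) (S : Type) (K H : hilbertType R).
Variables (g : S -> K) (f : S -> H).
Hypothesis g_total : cspan (range g) = setT.
Hypothesis f_dot : forall s t, dot (f s) (f t) = dot (g s) (g t).

(** The linear map between the algebraic spans, as a relation: it is not yet
    known to be single-valued. *)
Inductive lin_graph : K -> H -> Prop :=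
| LinGraph0 : lin_graph 0 0
| LinGraphD a k h k' h' : lin_graph k h -> lin_graph k' h' ->
    lin_graph (a *: k + k') (a *: h + h')
| LinGraphGen s : lin_graph (g s) (f s).

(** The closure of the graph, described by equations: linear and single-valued
    by construction, so that only existence has to be obtained from limits. *)
Definition weak_graph (k : K) (h : H) : Prop :=
  cspan (range f) h /\ forall s, dot (f s) h = dot (g s) k.

Lemma lin_graph_weak k h : lin_graph k h -> weak_graph k h.
Proof.
have hf := closed_subspace_cspan (range f).
elim=> [|a k1 h1 k2 h2 _ [c1 d1] _ [c2 d2]|s].
- by split; [exact: csub0|move=> s; rewrite !dot0r].
- split; first by apply: (csubD hf) => //; exact: (csubZ hf).
  by move=> s; rewrite !dot_linear d1 d2.
- by split; [apply: sub_cspan; exists s|move=> t; exact: f_dot].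
Qed.

Lemma weak_graph_unique k h h' : weak_graph k h -> weak_graph k h' -> h = h'.
Proof.
have hf := closed_subspace_cspan (range f).
move=> [c d] [c' d']; apply/eqP; rewrite -subr_eq0; apply/eqP/dotxx_eq0.
apply: (ortho_cspan (S := range f)); last exact: (csubB hf).
by move=> _ [s _ <-]; rewrite dotBr d d' subrr.
Qed.

Lemma lin_graph_dot k h k' h' : lin_graph k h -> weak_graph k' h' ->
  dot h h' = dot k k'.
Proof.
move=> kh [_ d]; elim: kh => [|a k1 h1 k2 h2 _ d1 _ d2|s]; first by rewrite !dot0l.
  by rewrite !dotDl !dotZl d1 d2.
exact: d.
Qed.

Lemma lin_graph_rnorm k h : lin_graph k h -> rnorm h = rnorm k.
Proof.
move=> kh; apply/eqP; rewrite -(@eqrXn2 _ 2) ?rnorm_ge0 //; apply/eqP/complexI.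
by rewrite -!dotxx; apply: lin_graph_dot => //; exact: lin_graph_weak.
Qed.

Lemma lin_graph_dense k e : 0 < e ->
  exists k' h', lin_graph k' h' /\ rnorm (k - k') < e.
Proof.
have : cspan (range g) k by rewrite g_total.
have hD : closed_subspace [set k |
    forall e, 0 < e -> exists k' h', lin_graph k' h' /\ rnorm (k - k') < e].
  split.
  - by move=> d d0; exists 0, 0; rewrite subr0 rnorm0; split=> //; exact: LinGraph0.
  - move=> a x y hx hy d d0.
    have a1 : 0 < cabs a + 1 by rewrite ltr_wpDl ?cabs_ge0.
    have [x' [h [xh xx']]] := hx (d / 2 / (cabs a + 1)) ltac:(by rewrite !divr_gt0).
    have [y' [h' [yh yy']]] := hy (d / 2) ltac:(by rewrite divr_gt0).
    exists (a *: x' + y'), (a *: h + h'); split; first exact: LinGraphD.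
    rewrite opprD addrACA -scalerBr; apply: le_lt_trans (ler_rnormD _ _) _.
    rewrite rnormZ (splitr d); apply: ler_ltD yy'.
    apply: le_trans (_ : (cabs a + 1) * rnorm (x - x') <= _).
      by rewrite ler_wpM2r ?rnorm_ge0 // lerDl ler01.
    by rewrite mulrC -ler_pdivlMr // ltW.
  - apply/closed_rnormP => x hx d d0; have d2 : 0 < d / 2 by rewrite divr_gt0.
    have [y hy xy] := hx _ d2; have [k' [h' [kh yk]]] := hy _ d2.
    exists k', h'; split=> //; apply: le_lt_trans (ler_rnorm_dist y _ _) _.
    by rewrite (splitr d) ltrD.
move=> /(cspan_ind hD); apply => _ [s _ <-] d d0.
by exists (g s), (f s); rewrite subrr rnorm0; split=> //; exact: LinGraphGen.
Qed.

Lemma weak_graph_exists k : exists h, weak_graph k h /\ rnorm h <= rnorm k.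
Proof.
pose P e := [set h | exists k', lin_graph k' h /\ rnorm (k - k') < e].
have [|||h hh] := @shrinking_limit R H P.
- by move=> e /(lin_graph_dense k)[k' [h [? ?]]]; exists h, k'.
- by move=> d e _ de h [k' [? kd]]; exists k'; split=> //; exact: lt_le_trans kd de.
- move=> e e0; exists (e / 2) => [|h h' [k1 [kh1 d1]] [k2 [kh2 d2]]].
    by rewrite divr_gt0.
  have := LinGraphD (-1) kh2 kh1; rewrite !scaleN1r ![- _ + _]addrC.
  move=> /lin_graph_rnorm ->; apply: le_lt_trans (ler_rnorm_dist k _ _) _.
  by rewrite (rnormBC k1) (splitr e) ltrD.
have approx e : 0 < e -> exists k' h',
    [/\ lin_graph k' h', rnorm (k - k') < e & rnorm (h - h') < e].
  move=> e0; have [d d0 hd] := hh _ e0.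
  have [|k' [h' [kh kk']]] := @lin_graph_dense k (Num.min d e).
    by rewrite lt_min d0.
  move: kk'; rewrite lt_min => /andP[kd ke]; exists k', h'; split=> //.
  by rewrite rnormBC; apply: hd; exists k'.
exists h; split; [split|].
- apply: (csub_lim (closed_subspace_cspan _)) => e /approx[k' [h' [kh _ ?]]].
  by exists h' => //; have [] := lin_graph_weak kh.
- move=> s; apply/eqP; rewrite -subr_eq0; apply/eqP.
  apply: cabs_eq0; apply/eqP; rewrite eq_le cabs_ge0 andbT leNgt; apply/negP.
  set c := cabs _ => c0; have C0 : 0 < rnorm (f s) + rnorm (g s) + 1.
    by rewrite ltr_wpDl // addr_ge0 // rnorm_ge0.
  have [k' [h' [kh kk' hh']]] := approx _ (divr_gt0 c0 C0).
  have [_ /(_ s) e'] := lin_graph_weak kh.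
  have : c <= cabs (dot (f s) (h - h')) + cabs (dot (g s) (k - k')).
    rewrite /c -(cabsN (dot (g s) (k - k'))); apply: le_trans (ler_cabsD _ _).
    by rewrite !dotBr e' opprB addrA subrK.
  have := cauchy_schwarz (f s) (h - h'); have := cauchy_schwarz (g s) (k - k').
  move: kk' hh'; rewrite !ltr_pdivlMr //.
  have := rnorm_ge0 (f s); have := rnorm_ge0 (g s).
  have := rnorm_ge0 (h - h'); have := rnorm_ge0 (k - k').
  by nra.
- rewrite leNgt; apply/negP => kh.
  have [k' [h' [/lin_graph_rnorm kh' ? ?]]] :=
    approx ((rnorm h - rnorm k) / 2) ltac:(by rewrite divr_gt0 // subr_gt0).
  have := ler_rnormD (h - h') h'; have := ler_rnormD (k' - k) k.
  rewrite !subrK rnormBC; lra.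
Qed.

(** Linearity comes from the uniqueness of the image in [weak_graph], and
    isometry from the generators, by totality. *)
Lemma isometric_extension : exists T : K -> H,
  isometry T /\ forall s, T (g s) = f s.
Proof.
have [T hT] := choice weak_graph_exists; exists T.
have Tg s : T (g s) = f s.
  by apply: weak_graph_unique (hT _).1 _; apply/lin_graph_weak/LinGraphGen.
have hf := closed_subspace_cspan (range f).
have lT : linear T.
  move=> a x y; apply: (weak_graph_unique (hT _).1); split.
    by apply: (csubD hf); [apply: (csubZ hf)|]; exact: (hT _).1.1.
  by move=> s; rewrite !dot_linear !(hT _).1.2.
have bT : bounded_op T.
  by apply/bounded_opP; split=> //; exists 1 => // x; rewrite mul1r; exact: (hT x).2.
split=> //; split=> // x y.
suff : dot y x = dot (T y) (T x).
  by move=> yx; rewrite dot_conj -yx -dot_conj.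
apply: (eq_on_total (g := g) (D := setT) (K := R[i]^o)
  (T := fun x => dot (T y) (T x)) (bounded_dot y)) => //.
  exact: (bounded_op_comp (bounded_dot (T y)) bT).
move=> s _; rewrite Tg dot_conj [RHS]dot_conj; congr Num.conj.
by rewrite (hT y).1.2.
Qed.

Lemma bounded_ext_isometry : isometry (bounded_ext g f) /\
  forall s, bounded_ext g f (g s) = f s.
Proof.
have [T [iT Tg]] := isometric_extension.
have [bE Eg] : bounded_op (bounded_ext g f) /\ forall s, bounded_ext g f (g s) = f s.
  rewrite /bounded_ext; case: xgetP => [_ -> []//|/(_ T)].
  by case; split=> //; exact: isometry_bounded.
have -> : bounded_ext g f = T; last by [].
apply/funext/(eq_on_total (g := g) (D := setT)) => //; first exact: isometry_bounded.
by move=> s _; rewrite Eg Tg.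
Qed.

End IsometricExtension.

(** * Representations are contractive *)

Section CStarAlgebra.
Variables (R : realType) (A : cstarAlgType R).
Implicit Types a b c : A.

Lemma rnorm_cmul a b : rnorm (cmul a b) <= rnorm a * rnorm b.
Proof. by rewrite -lecR rmorphM /= -!rnormE cmul_norm. Qed.

Lemma rnorm_star_cmul a : rnorm (cmul (star a) a) = rnorm a ^+ 2.
Proof. by apply: complexI; rewrite rmorphXn /= -!rnormE cstar_norm. Qed.

Lemma cmulBl a b c : cmul (a - b) c = cmul a c - cmul b c.
Proof.
by have := cmul_linearl (-1) b a c; rewrite !scaleN1r addrC => ->; rewrite addrC.
Qed.

(** With a unit, [d] would be [(1 - c)^-1 - 1]; it is the fixed point of the
    contraction [d |-> c + d c]. *)
Lemma quasi_inverse c : rnorm c < 1 -> exists d, d = c + cmul d c.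
Proof.
move=> c1; have c0 := rnorm_ge0 c.
pose F d := c + cmul d c.
have FB x y : rnorm (F x - F y) <= rnorm c * rnorm (x - y).
  rewrite /F opprD addrACA subrr add0r -cmulBl mulrC; exact: rnorm_cmul.
pose P e := [set d | rnorm (d - F d) < e].
have P0 e : 0 < e -> P e !=set0.
  move=> e0; have defect n :
      rnorm (iter n F 0 - F (iter n F 0)) <= rnorm c ^+ n * rnorm (0 - F 0).
    elim: n => [|n IH]; first by rewrite expr0 mul1r.
    rewrite iterS; apply: le_trans (FB _ _) _.
    by rewrite exprS -mulrA ler_wpM2l.
  have D0 : 0 < rnorm (0 - F 0) + 1 by rewrite ltr_wpDl ?rnorm_ge0.
  have cn : (fun n => rnorm c ^+ n) @ \oo --> (0 : R).
    by apply: cvg_expr; rewrite ger0_norm.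
  have /cvgr0Pnorm_lt/(_ (e / (rnorm (0 - F 0) + 1))) := cn.
  case=> [|n _ /(_ n (leqnn n)) hn]; first by rewrite divr_gt0.
  exists (iter n F 0); apply: le_lt_trans (defect n) _.
  move: hn; rewrite ger0_norm ?exprn_ge0 // ltr_pdivlMr //.
  by apply: le_lt_trans; rewrite ler_wpM2l ?exprn_ge0 // lerDl ler01.
have [||d hd] := @shrinking_limit R A P P0.
- by move=> d e _ de x /lt_le_trans; apply.
- move=> e e0; have q0 : 0 < 1 - rnorm c by rewrite subr_gt0.
  exists (e * (1 - rnorm c) / 2) => [|x y hx hy]; first by rewrite divr_gt0 ?mulr_gt0.
  have := ler_rnorm_dist (F x) x y; have := ler_rnorm_dist (F y) (F x) y.
  have := FB x y; move: hx hy; rewrite /P /= (rnormBC y) => hx hy h1 h2 h3.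
  rewrite -(ltr_pM2r q0); lra.
exists d; apply/eqP; rewrite -subr_eq0; apply/eqP/rnorm_small => e e0.
have e4 : 0 < e / 4 by rewrite divr_gt0.
have [a a0 ha] := hd _ e4.
have [|x] := P0 (Num.min a (e / 4)); first by rewrite lt_min a0.
rewrite /P /= lt_min => /andP[/ha xd xe].
have := ler_rnorm_dist x d (F d); have := ler_rnorm_dist (F x) x (F d).
have := FB x d; have := ler_wpM2r (rnorm_ge0 (x - d)) (ltW c1).
rewrite (rnormBC d x); lra.
Qed.
End CStarAlgebra.

Section Representation.
Variables (R : realType) (A : cstarAlgType R) (H : hilbertType R).
Variable sigma : representation A H.
Implicit Types (a b : A) (h : H).

Lemma repD a b h : sigma (a + b) h = sigma a h + sigma b h.
Proof. by have := rep_linear sigma 1 a b h; rewrite !scale1r. Qed.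

Lemma rep0 h : sigma 0 h = 0.
Proof.
by have := rep_linear sigma (-1) 0 0 h; rewrite scaleN1r oppr0 addr0 scaleN1r addNr.
Qed.

Lemma repZ k a h : sigma (k *: a) h = k *: sigma a h.
Proof. by have := rep_linear sigma k a 0 h; rewrite rep0 !addr0. Qed.

Lemma rep_lin a : linear (sigma a). Proof. by case: (rep_bounded sigma a). Qed.

Lemma rep_star_mul b h : dot h (sigma (cmul (star b) b) h) = (rnorm (sigma b h) ^+ 2)%:C.
Proof. by rewrite rep_mul -dotxx rep_star. Qed.

(** Let [s] be the supremum of [|sigma b h|^2] over the unit ball and suppose
    [s > 1]. Then [c := b^* b / s] has norm less than 1, and its quasi-inverse
    bounds [1 - sigma c] from below. But for unit vectors [h] with
    [|sigma b h|^2] close to [s], [sigma c h] is close to [h]: a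
    contradiction. *)
Lemma rep_strict_contraction b : rnorm b < 1 ->
  forall h, rnorm (sigma b h) ^+ 2 <= rnorm h ^+ 2.
Proof.
move=> b1; have /bounded_opP[lb [C C0 hC]] := rep_bounded sigma b.
pose E := [set rnorm (sigma b h) ^+ 2 | h in [set h | rnorm h <= 1]].
have E0 : E !=set0 by exists (rnorm (sigma b 0) ^+ 2), 0 => //=; rewrite rnorm0.
have sE : has_sup E.
  split=> //; exists (C ^+ 2) => _ [h /= h1 <-].
  rewrite ler_sqr ?nnegrE ?rnorm_ge0 ?(ltW C0) //; apply: le_trans (hC h) _.
  by rewrite ger_pMr.
pose s := sup E.
have b_le h : rnorm (sigma b h) ^+ 2 <= s * rnorm h ^+ 2.
  have [h0|h0] := eqVneq (rnorm h) 0.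
    by rewrite (rnorm_eq0 h0) (linear_zero lb) rnorm0 expr0n mulr0.
  have hp : 0 < rnorm h by rewrite lt_neqAle eq_sym h0 rnorm_ge0.
  have ip : 0 <= (rnorm h)^-1 by rewrite invr_ge0 ltW.
  have : rnorm (sigma b ((rnorm h)^-1%:C *: h)) ^+ 2 <= s.
    apply: (ub_le_sup sE.2); exists ((rnorm h)^-1%:C *: h) => //=.
    by rewrite rnormZ (cabs_real ip) mulVf.
  rewrite (linear_scale lb) rnormZ (cabs_real ip) exprMn exprVn.
  by rewrite ler_pdivrMl ?exprn_gt0 // mulrC.
suff s1 : s <= 1.
  by move=> h; apply: le_trans (b_le h) _; rewrite ler_piMl ?sqr_ge0.
rewrite leNgt; apply/negP => s1; have s0 : 0 < s by rewrite (lt_trans ltr01).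
have is0 : 0 <= s^-1 by rewrite invr_ge0 ltW.
pose c := s^-1%:C *: cmul (star b) b.
have [d dE] : exists d, d = c + cmul d c.
  apply: quasi_inverse; rewrite /c rnormZ (cabs_real is0) rnorm_star_cmul.
  rewrite ltr_pdivrMl // mulr1; apply: lt_trans s1.
  by rewrite expr_lt1 ?rnorm_ge0.
have /bounded_opP[ld [D D0 hD]] := rep_bounded sigma d.
have star_le h : rnorm (sigma (star b) h) ^+ 2 <= s * rnorm h ^+ 2.
  have := Re_dot_le h (sigma b (sigma (star b) h)).
  have -> : dot h (sigma b (sigma (star b) h)) = (rnorm (sigma (star b) h) ^+ 2)%:C.
    by rewrite -[b in sigma b]starK -rep_star dotxx.
  move=> /= le1; have := b_le (sigma (star b) h).
  set u := rnorm (sigma (star b) h) in le1 *.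
  set v := rnorm (sigma b _) in le1 * => le2.
  have u0 : 0 <= u by exact: rnorm_ge0.
  have v0 : 0 <= v by exact: rnorm_ge0.
  have n0 : 0 <= rnorm h by exact: rnorm_ge0.
  have [->|un0] := eqVneq u 0; first by rewrite expr0n mulr_ge0 ?sqr_ge0 ?ltW.
  have up : 0 < u ^+ 2 by rewrite exprn_gt0 // lt_neqAle eq_sym un0.
  have : u ^+ 2 * u ^+ 2 <= u ^+ 2 * (s * rnorm h ^+ 2).
    apply: le_trans (_ : rnorm h ^+ 2 * v ^+ 2 <= _).
      by rewrite -!exprMn -expr2 ler_sqr ?nnegrE ?mulr_ge0 ?sqr_ge0.
    by have := ler_wpM2l (sqr_ge0 (rnorm h)) le2; lra.
  by rewrite ler_pM2l.
(* [(1 + sigma d) (1 - sigma c) = 1]. *)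
have lower h : rnorm h <= (1 + D) * rnorm (h - sigma c h).
  have -> : rnorm h = rnorm ((h - sigma c h) + sigma d (h - sigma c h)).
    rewrite (linear_sub ld) -rep_mul {1}dE repD !addrA.
    by rewrite subrK addrK.
  by apply: le_trans (ler_rnormD _ _) _; rewrite mulrDl mul1r lerD2l.
(* The quantitative form of: if [sigma b] nearly attains its norm at [h], then
   [sigma c] nearly fixes [h]. *)
have gap h : rnorm (h - sigma c h) ^+ 2 <= rnorm h ^+ 2 - s^-1 * rnorm (sigma b h) ^+ 2.
  have cE : dot h (sigma c h) = (s^-1 * rnorm (sigma b h) ^+ 2)%:C.
    by rewrite repZ dotZr rep_star_mul -rmorphM.
  rewrite rnormB_sqr cE /=.
  have : rnorm (sigma c h) ^+ 2 <= s^-1 * rnorm (sigma b h) ^+ 2.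
    rewrite /c repZ rnormZ (cabs_real is0) exprMn rep_mul expr2 -mulrA ler_wpM2l //.
    by rewrite ler_pdivrMl //; exact: star_le.
  lra.
pose L := 1 + D; have L0 : 0 < L by rewrite addr_gt0.
have : s <= s * (1 - (L ^+ 2)^-1).
  apply: (ge_sup E0) => _ [h /= h1 <-].
  have := lower h; rewrite -ler_sqr ?nnegrE ?mulr_ge0 ?rnorm_ge0 ?(ltW L0) //.
  rewrite exprMn -/L => /le_trans /(_ (ler_wpM2l (sqr_ge0 _) (gap h))).
  rewrite mulrC -ler_pdivrMr ?exprn_gt0 // => le1.
  have h2 : rnorm h ^+ 2 <= 1 by rewrite expr_le1 ?rnorm_ge0.
  have iL : (L ^+ 2)^-1 <= 1.
    by rewrite invf_le1 ?exprn_gt0 // exprn_ege1 // lerDl ltW.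
  rewrite -ler_pdivrMl //; nra.
have : 0 < (L ^+ 2)^-1 by rewrite invr_gt0 exprn_gt0.
by move=> iL; nra.
Qed.

(** Automatic continuity of representations, from the previous lemma by scaling
    [b] to a norm slightly less than 1. *)
Lemma rep_contraction b h : rnorm (sigma b h) <= rnorm b * rnorm h.
Proof.
apply/ler_addgt0Pr => e e0; have n1 : 0 < rnorm h + 1 by rewrite ltr_wpDl ?rnorm_ge0.
pose r := rnorm b + e / (rnorm h + 1).
have r0 : 0 < r by rewrite ltr_wpDl ?rnorm_ge0 ?divr_gt0.
have ir0 : 0 <= r^-1 by rewrite invr_ge0 ltW.
have : rnorm (sigma (r^-1%:C *: b) h) <= rnorm h.
  rewrite -ler_sqr ?nnegrE ?rnorm_ge0 //; apply: rep_strict_contraction.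
  by rewrite rnormZ (cabs_real ir0) ltr_pdivrMl // mulr1 ltrDl divr_gt0.
rewrite repZ rnormZ (cabs_real ir0) ler_pdivrMl // => /le_trans; apply.
rewrite mulrDl lerD2l mulrAC ler_pdivrMr // ler_wpM2l ?(ltW e0) //.
by rewrite lerDl ler01.
Qed.

End Representation.

(** * Elementary tensors *)

Section HilbertModule.
Variables (R : realType) (A : cstarAlgType R) (F : hilbertModType A).

Lemma ipBr (x y z : F) : ip x (y - z) = ip x y - ip x z.
Proof.
by have := ip_linear x (-1) z y; rewrite !scaleN1r addrC => ->; rewrite addrC.
Qed.

Lemma ip_inj (x y : F) : (forall z, ip z x = ip z y) -> x = y.
Proof.
move=> h; apply/eqP; rewrite -subr_eq0; apply/eqP/rnorm_eq0/eqP.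
rewrite -sqrf_eq0; apply/eqP/complexI.
by rewrite rmorphXn /= -rnormE ip_norm ipBr h subrr normr0.
Qed.

Lemma rnorm_ip (x : F) : rnorm (ip x x) = rnorm x ^+ 2.
Proof. by apply: complexI; rewrite rmorphXn /= -!rnormE ip_norm. Qed.

End HilbertModule.

Lemma ract_lact (R : realType) (A : cstarAlgType R) (F : corrType A)
    (x : F) (a b : A) : ract (lact b x) a = lact b (ract x a).
Proof.
apply: ip_inj => z; rewrite ip_ract -[b]starK -!lact_adj.
by rewrite ip_ract.
Qed.

Section HilbertTensor.
Variables (R : realType) (A : cstarAlgType R) (H : hilbertType R).
Variables (sigma : representation A H) (F : hilbertModType A).
Variable K : hilbert_tensor F sigma.

Lemma htens_inj (u v : K) :
  (forall x h, dot (htens K x h) u = dot (htens K x h) v) -> u = v.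
Proof.
by move=> h; apply: (total_dot_inj (htens_total K)) => _ [p _ <-].
Qed.

Lemma bounded_htensr (x : F) : bounded_op (htens K x).
Proof.
apply/bounded_opP; split=> [k h h'|].
  by apply: htens_inj => y g; rewrite dot_linear !htens_dot rep_lin dot_linear.
exists (rnorm x + 1) => [|h]; first by rewrite ltr_wpDl ?rnorm_ge0.
apply: le_trans (_ : rnorm x * rnorm h <= _); last first.
  by rewrite ler_wpM2r ?rnorm_ge0 // lerDl ler01.
rewrite -ler_sqr ?nnegrE ?mulr_ge0 ?rnorm_ge0 //.
have -> : rnorm (htens K x h) ^+ 2 = complex.Re (dot h (sigma (ip x x) h)).
  by rewrite -(htens_dot K) dotxx.
apply: le_trans (Re_dot_le _ _) _; rewrite exprMn -rnorm_ip.
by rewrite mulrC expr2 mulrA ler_wpM2r ?rnorm_ge0 // rep_contraction.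
Qed.

(** This is where contractivity of [sigma] is needed: the norm of [x (x) h]
    involves [sigma (ip x x)]. *)
Lemma bounded_htensl (h : H) : bounded_op (fun x : F => htens K x h).
Proof.
apply/bounded_opP; split=> [k x y|].
  apply: htens_inj => z g.
  by rewrite dot_linear !htens_dot ip_linear rep_linear dot_linear.
exists (rnorm h + 1) => [|x]; first by rewrite ltr_wpDl ?rnorm_ge0.
apply: le_trans (_ : rnorm h * rnorm x <= _); last first.
  by rewrite ler_wpM2r ?rnorm_ge0 // lerDl ler01.
rewrite -ler_sqr ?nnegrE ?mulr_ge0 ?rnorm_ge0 //.
have -> : rnorm (htens K x h) ^+ 2 = complex.Re (dot h (sigma (ip x x) h)).
  by rewrite -(htens_dot K) dotxx.
apply: le_trans (Re_dot_le _ _) _; rewrite exprMn -rnorm_ip.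
by rewrite expr2 -mulrA ler_wpM2l ?rnorm_ge0 // mulrC rep_contraction.
Qed.

End HilbertTensor.

(** Total families of [F (x) G] and of [(F (x) G) (x) H] combine because
    [z |-> z (x) h] is continuous. *)
Lemma htens_ctens_total (R : realType) (A : cstarAlgType R) (H : hilbertType R)
    (sigma : representation A H) (F G : corrType A) (FG : corr_tensor F G)
    (K : hilbert_tensor FG sigma) :
  cspan (range (fun p : F * G * H => htens K (ctens FG p.1.1 p.1.2) p.2)) = setT.
Proof.
set S := cspan _; rewrite -subTset -(htens_total K); apply: cspan_ind.
  exact: closed_subspace_cspan.
move=> _ [[z h] _ <-] /=.
have : cspan [set ctens FG p.1 p.2 | p in @setT (F * G)] z by rewrite ctens_total.
apply: (cspan_ind (P := (fun z => htens K z h) @^-1` S)).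
  apply: closed_subspace_preimage (bounded_htensl K h) _.
  exact: closed_subspace_cspan.
by move=> _ [[x y] _ <-]; apply: sub_cspan; exists (x, y, h).
Qed.

(** * Isometric covariant representations of one correspondence *)

(** The second clause is [V(y)^* V(x) = sigma(ip y x)], in the form it takes
    through the inner product of [H]. *)
Definition iso_covariant (R : realType) (A : cstarAlgType R) (H : hilbertType R)
    (F : corrType A) (sigma : representation A H) (V : F -> H -> H) : Prop :=
  covariant sigma V /\ forall x y h k, dot (V y k) (V x h) = dot k (sigma (ip y x) h).

Section IsometricCovariant.
Variables (R : realType) (A : cstarAlgType R) (H : hilbertType R).
Variables (sigma : representation A H) (F : corrType A) (V : F -> H -> H).
Hypothesis hV : iso_covariant sigma V.

Section Tilde.
Variable K : hilbert_tensor F sigma.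

Lemma tildeP : isometry (tilde (K := K) V) /\
  forall x h, tilde V (htens K x h) = V x h.
Proof.
have [|s t|iT ET] := @bounded_ext_isometry R (F * H) K H
  (fun p => htens K p.1 p.2) (fun p => V p.1 p.2).
- exact: htens_total.
- by rewrite hV.2 htens_dot.
- by split=> // x h; exact: ET (x, h).
Qed.
End Tilde.

(** The difference of both sides is a combination of vectors of the form
    [V y k], and it is orthogonal to all of them. *)
Lemma covariant_ract (x : F) (a : A) (h : H) : V (ract x a) h = V x (sigma a h).
Proof.
have w0 y k : dot (V y k) (V (ract x a) h - V x (sigma a h)) = 0.
  by rewrite dotBr !hV.2 ip_ract rep_mul subrr.
apply/eqP; rewrite -subr_eq0; apply/eqP/dotxx_eq0.
by rewrite dotBl !w0 subrr.
Qed.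

(** The two-sided covariance relation determines [V (lact b x)] on the vectors
    [sigma a k] only; these are total since [sigma] is nondegenerate. *)
Lemma covariant_lact (x : F) (b : A) (h : H) : V (lact b x) h = sigma b (V x h).
Proof.
have [[bV _ _ cV] _] := hV.
apply: (eq_on_total (g := fun p : A * H => sigma p.1 p.2) (D := setT)
  (T := sigma b \o V x) (bV _)).
- by apply: bounded_op_comp => //; exact: rep_bounded.
- exact: rep_nondegenerate.
- by move=> [a k] _ /=; rewrite -covariant_ract ract_lact cV.
Qed.

End IsometricCovariant.

(** * The operator I (x) T *)

Section IdTens.
Variables (R : realType) (A : cstarAlgType R) (H : hilbertType R).
Variables (sigma : representation A H) (F G : corrType A) (FG : corr_tensor F G).
Variables (KFG : hilbert_tensor FG sigma) (KF : hilbert_tensor F sigma).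
Variables (KG : hilbert_tensor G sigma) (V : G -> H -> H).
Hypothesis hV : iso_covariant sigma V.

Let T : KG -> H := tilde V.
Let J : KFG -> KF := id_tens KF T.
Let W := ortho (range T).
Let N := cspan [set htens KF p.1 p.2 | p in [set p : F * H | W p.2]].

Lemma id_tensP : isometry J /\
  forall x y h, J (htens KFG (ctens FG x y) h) = htens KF x (V y h).
Proof.
have [iT ET] : isometry T /\ forall y h, T (htens KG y h) = V y h := tildeP hV KG.
have [|s t|iJ EJ] := @bounded_ext_isometry R (F * G * H) KFG KF
  (fun p => htens KFG (ctens FG p.1.1 p.1.2) p.2)
  (fun p => htens KF p.1.1 (T (htens KG p.1.2 p.2))).
- exact: htens_ctens_total.
- by rewrite !htens_dot !ET -(covariant_lact hV) hV.2 ctens_ip.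
- by split=> // x y h; rewrite -ET; exact: EJ (x, y, h).
Qed.

(** [F (x) H] is the orthogonal sum of [F (x) range T] and of its part over the
    complement of [range T]: the two parts are orthogonal because [sigma]
    leaves [range T] invariant, and they span since every [x (x) h] splits
    along the projection of [h] onto [range T]. *)
Lemma range_id_tens : range J = ortho N.
Proof.
have [iT ET] : isometry T /\ forall y h, T (htens KG y h) = V y h := tildeP hV KG.
have [iJ EJ] := id_tensP.
have hrT := closed_subspace_range iT; have hrJ := closed_subspace_range iJ.
have hN : closed_subspace N by exact: closed_subspace_cspan.
have rJN : range J `<=` ortho N.
  move=> _ [u _ <-].
  have : cspan (range (fun p : F * G * H => htens KFG (ctens FG p.1.1 p.1.2) p.2)) u.
    by rewrite htens_ctens_total.
  apply: (cspan_ind (P := J @^-1` ortho N)).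
    apply: closed_subspace_preimage (isometry_bounded iJ) _.
    exact: closed_subspace_ortho.
  move=> _ [[[x y] h] _ <-]; rewrite /preimage /= EJ; apply: ortho_cspan.
  move=> _ [[x' w] /= Ww <-]; rewrite htens_dot -(covariant_lact hV).
  by apply: orthoC Ww; exists (htens KG (lact (ip x' x) y) h).
apply/seteqP; split=> // v Nv.
suff -> : v = proj (range J) v by exact: proj_in.
apply/eqP; rewrite -subr_eq0; apply/eqP; set u := v - _.
have Ju : ortho (range J) u by exact: proj_ortho.
have Nu : ortho N u.
  apply: (csubB (closed_subspace_ortho N)) => //.
  by apply: rJN; exact: proj_in.
have JT k x : range J (htens KF x (T k)).
  have : cspan [set htens KG p.1 p.2 | p in @setT (G * H)] k by rewrite htens_total.
  apply: (cspan_ind (P := (htens KF x \o T) @^-1` range J)).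
    apply: closed_subspace_preimage hrJ.
    exact: bounded_op_comp (bounded_htensr KF x) (isometry_bounded iT).
  move=> _ [[y h] _ <-]; exists (htens KFG (ctens FG x y) h) => //.
  by rewrite EJ /= ET.
apply: (htens_inj (K := KF)) => x h; rewrite dot0r.
rewrite -(subrK (proj (range T) h) h) (linear_add (bounded_htensr KF x).1) dotDl.
rewrite Nu ?Ju ?addr0 //.
  by have [k _ <-] := proj_in hrT h; exact: JT.
apply: sub_cspan; exists (x, h - proj (range T) h) => //=.
exact: proj_ortho.
Qed.
End IdTens.

Lemma unitary_iso_sym (R : realType) (A : cstarAlgType R) (F G : corrType A)
    (t : F -> G) (t' : G -> F) : unitary_iso t t' -> unitary_iso t' t.
Proof.
move=> [[lt ipt] tr tl [tK t'K]]; have tI := can_inj tK.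
split=> //; [split|..].
- by move=> a x y; apply: tI; rewrite lt !t'K.
- by move=> x y; rewrite -ipt !t'K.
- by move=> x a; apply: tI; rewrite tr !t'K.
- by move=> a x; apply: tI; rewrite tl !t'K.
Qed.

Lemma tens_idP (R : realType) (A : cstarAlgType R) (H : hilbertType R)
    (sigma : representation A H) (F G : corrType A)
    (KF : hilbert_tensor F sigma) (KG : hilbert_tensor G sigma)
    (t : F -> G) (t' : G -> F) : unitary_iso t t' ->
  isometry (tens_id (KF := KF) KG t) /\ range (tens_id (KF := KF) KG t) = setT.
Proof.
move=> [[lt ipt] _ _ [tK t'K]].
have [|p q|iJ EJ] := @bounded_ext_isometry R (F * H) KF KG
  (fun p => htens KF p.1 p.2) (fun p => htens KG (t p.1) p.2).
- exact: htens_total.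
- by rewrite !htens_dot ipt.
split=> //; rewrite -subTset -(htens_total KG); apply: cspan_ind.
  exact: closed_subspace_range.
move=> _ [[z h] _ <-]; exists (htens KF (t' z) h) => //.
by have := EJ (t' z, h); rewrite /= t'K.
Qed.

(** * Differences of two projections *)

(** Log-convexity of the norms of the powers of a self-adjoint operator, from
    [|D z|^2 <= |z| |D^2 z|] and [|D^2 z|^2 <= |D z| |D^3 z|]. It reduces the
    compactness of [D] to that of [D^3]. *)
Lemma rnorm_cube_le (R : realType) (H : hilbertType R) (D : H -> H) (z : H) :
  (forall x y, dot (D x) y = dot x (D y)) ->
  rnorm (D z) ^+ 3 <= rnorm z ^+ 2 * rnorm (D (D (D z))).
Proof.
move=> sD; have h1 := Re_dot_le z (D (D z)).
have h2 := Re_dot_le (D z) (D (D (D z))).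
move: h1 h2; rewrite -sD dotxx -sD dotxx /=.
have := rnorm_ge0 z; have := rnorm_ge0 (D (D (D z))).
have := rnorm_ge0 (D (D z)); have [->|Dz0] := eqVneq (rnorm (D z)) 0.
  by move=> *; rewrite expr0n /= mulr_ge0 ?sqr_ge0.
have : 0 < rnorm (D z) by rewrite lt_neqAle eq_sym Dz0 rnorm_ge0.
set a := rnorm (D z); set b := rnorm (D (D z)); set c := rnorm (D (D (D z))).
set n := rnorm z => a0 b0 c0 n0 h1 h2.
rewrite -(ler_pM2l a0).
apply: le_trans (_ : n ^+ 2 * b ^+ 2 <= _).
  have : (a ^+ 2) ^+ 2 <= (n * b) ^+ 2 by rewrite ler_sqr ?nnegrE ?sqr_ge0 ?mulr_ge0.
  lra.
have := ler_wpM2l (sqr_ge0 n) h2; lra.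
Qed.

Section DefectCompact.
Variables (R : realType) (H K : hilbertType R) (T : K -> H).
Variables (W : set H) (N : set K).
Hypotheses (iT : isometry T) (hW : closed_subspace W) (hN : closed_subspace N).

(* [q] is the projection onto [T N]. On [W], [Fad] is the adjoint of the operator
   [p T] from [N] to [W], whose two defects are [defW] and [defN]. *)
Let p := proj W.
Let Fad (h : H) : K := proj N (adj T h).
Let q h := T (Fad h).
Let D h := p h - q h.
Let defW h := h - p (T (Fad h)).
Let defN u := u - Fad (p (T u)).

Let lT : linear T := isometry_linear iT.
Let lp : linear p := proj_linear hW.
Let bFad : bounded_op Fad := bounded_op_comp (bounded_proj hN) (adj_bounded iT).
Let lF : linear Fad. Proof. by case: bFad. Qed.
Let pp h : p (p h) = p h. Proof. by rewrite /p (proj_id hW) //; exact: proj_in. Qed.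
Let FTF h : Fad (T (Fad h)) = Fad h.
Proof. by rewrite /Fad isometryK // proj_id //; exact: proj_in. Qed.
Let lD : linear D.
Proof. by move=> a x y; rewrite /D /q lp lF lT scalerBr opprD addrACA. Qed.
Let rnorm_F h : rnorm (Fad h) <= rnorm h.
Proof. exact: le_trans (rnorm_proj_le hN _) (rnorm_adj_le iT _). Qed.

Lemma dot_proj_diff x y : dot (D x) y = dot x (D y).
Proof.
have dT a b : dot (T a) b = dot a (adj T b) := dot_adj (isometry_bounded iT) a b.
have dT' a b : dot a (T b) = dot (adj T a) b by rewrite dot_conj dT -dot_conj.
by rewrite /D dotBl dotBr dot_proj // /q dT dT' dot_proj.
Qed.

(** [(p - q)^3 = (p - p q p) - (q - q p q)], each side of the difference being
    carried by one of the two defects. *)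
Lemma proj_diff_cube x : D (D (D x)) = defW (p x) - T (defN (Fad x)).
Proof.
have pD y : p (D y) = p y - p (T (Fad y)) by rewrite /D (linear_sub lp) pp.
have FD y : Fad (D y) = Fad (p y) - Fad y by rewrite /D (linear_sub lF) FTF.
have pDD : p (D (D x)) = defW (p x).
  rewrite !pD FD (linear_sub lT) (linear_sub lp) opprB addrA subrK.
  by rewrite /defW.
have FDD : Fad (D (D x)) = defN (Fad x).
  by rewrite !FD pD (linear_sub lF) opprB addrC subrKA.
by rewrite {1}/D pDD /q FDD.
Qed.

(** [p - p q p = p (p - q) p]. *)
Lemma defW_eq h : W h -> defW h = p (D h).
Proof. by move=> Wh; rewrite /D (linear_sub lp) pp /defW {2}/p proj_id. Qed.

(** [q - q p q = - q (p - q) q], transported to [N] by [T]. *)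
Lemma defN_eq u : N u -> defN u = - Fad (D (T u)).
Proof.
move=> Nu; rewrite /D (linear_sub lF) FTF opprB /defN; congr (_ - _).
by rewrite /Fad isometryK // proj_id.
Qed.

Lemma compact_proj_diff : compact_op D <->
  compact_op_on W defW /\ compact_op_on N defN.
Proof.
rewrite /compact_op !compact_op_onP; split=> [cD|[c1 c2]].
  split.
    have cDW : precompact_on [set x | W x /\ rnorm x <= 1] D.
      by apply: (precompact_comp (f := id)) cD => x [].
    apply: (precompact_dominated cDW cDW) => e e0;
    exists e => // x y [Wx _] [Wy _] xy _.
    rewrite !defW_eq // -(linear_sub lp); apply: le_lt_trans xy.
    exact: rnorm_proj_le.
  have cDT : precompact_on [set u | N u /\ rnorm u <= 1] (D \o T).
    apply: (precompact_comp (f := T)) cD => u [_ u1].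
    by split; rewrite ?(rnorm_isometry iT).
  apply: (precompact_dominated cDT cDT) => e e0; exists e => // x y [Nx _] [Ny _] xy _.
  rewrite !defN_eq // opprK addrC -(linear_sub lF).
  apply: le_lt_trans (rnorm_F _) _; rewrite rnormBC; exact: xy.
have c1' : precompact_on [set x | setT x /\ rnorm x <= 1] (defW \o p).
  apply: (precompact_comp (f := p)) c1 => x [_ x1]; split; first exact: proj_in.
  exact: le_trans (rnorm_proj_le hW _) x1.
have c2' : precompact_on [set x | setT x /\ rnorm x <= 1] (defN \o Fad).
  apply: (precompact_comp (f := Fad)) c2 => x [_ x1]; split; first exact: proj_in.
  exact: le_trans (rnorm_F _) x1.
apply: (precompact_dominated c1' c2') => e e0.
(* For [x], [y] in the unit ball, [|x - y|^2 <= 4], and the two defects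
   contribute less than [2 d] to [D^3 (x - y)]; with [8 d = e^3] the bound
   [|D (x - y)|^3 <= 4 * 2 d] is what is wanted. *)
exists (e ^+ 3 / 8) => [|x y [_ x1] [_ y1] h1 h2]; first by rewrite divr_gt0 ?exprn_gt0.
have z2 : rnorm (x - y) <= 2 by apply: le_trans (ler_rnormB _ _) _; lra.
have := rnorm_cube_le (x - y) dot_proj_diff.
have -> : D (D (D (x - y))) = (defW (p x) - defW (p y)) - T (defN (Fad x) - defN (Fad y)).
  rewrite (linear_sub lD x) (linear_sub lD (D x)) (linear_sub lD (D (D x))).
  rewrite !proj_diff_cube (linear_sub lT (defN (Fad x))).
  move: (defW _) (defW _) (T (defN _)) (T (defN _)) => a b c d.
  by rewrite !opprD !opprK addrACA.
have h3 := ler_rnormB (defW (p x) - defW (p y)) (T (defN (Fad x) - defN (Fad y))).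
rewrite (rnorm_isometry iT) in h3.
have z4 : rnorm (x - y) ^+ 2 <= 4.
  by have := rnorm_ge0 (x - y); move=> ?; nra.
rewrite -(linear_sub lD) => h4.
rewrite -(@ltr_pXn2r _ 3) ?nnegrE ?rnorm_ge0 ?(ltW e0) //.
apply: le_lt_trans h4 _.
have := ler_wpM2r (rnorm_ge0 (defW (p x) - defW (p y) - T (defN (Fad x) - defN (Fad y)))) z4.
move: h1 h2 => /=; lra.
Qed.

End DefectCompact.

(** * The joint defect operator *)

Lemma ord2_neq (i j : 'I_2) : i != j -> (i = 0 /\ j = 1) \/ (i = 1 /\ j = 0).
Proof.
by case: i j => [[|[|//]] ?] [[|[|//]] ?] //= _; [left|right]; split; exact: val_inj.
Qed.

Section IsometricRep.
Variables (R : realType) (A : cstarAlgType R) (E : product_system A).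
Variables (H : hilbertType R) (sigma : representation A H).
Variables (K : tensor_spaces E sigma) (V : covariant_rep K).
Hypothesis V_isometric : isometric V.

Lemma isometric_iso_covariant i : iso_covariant sigma (V i).
Proof.
split=> [|x y h k]; first exact: cr_covariant.
have [bV _ _ _] := cr_covariant V i.
by rewrite (dot_adj (bV y)) V_isometric.
Qed.

Lemma isometry_Vtilde i : isometry (Vtilde V (i := i)).
Proof. exact: (tildeP (isometric_iso_covariant i) (K i)).1. Qed.

Lemma isometry_Vtilde12 : isometry (Vtilde12 V).
Proof.
apply: isometry_comp (isometry_Vtilde 0) _.
exact: (id_tensP (ts_12 K) (K 0) (K 1) (isometric_iso_covariant 1)).1.
Qed.

(** The range of [Vtilde12] has the same description for both orders of the two
    factors: for [i = 1] through the commutation relation, in which the unitary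
    [t_{1,2} (x) I] does not change ranges. *)
Lemma range_Vtilde12 i j : i != j ->
  range (Vtilde12 V) =
  Vtilde V (i := i) @` ortho (tens_wandering V i j).
Proof.
case/ord2_neq => -[-> ->].
  rewrite /tens_wandering.
  rewrite -(range_id_tens (ts_12 K) (K 0) (K 1) (isometric_iso_covariant 1)).
  by rewrite image_comp.
rewrite /tens_wandering.
rewrite -(range_id_tens (ts_21 K) (K 1) (K 0) (isometric_iso_covariant 0)).
have [|_ rt] := tens_idP (ts_12 K) (ts_21 K)
  (t := @ps_t12 R A E) (t' := @ps_t21 R A E).
  exact: unitary_iso_sym (ps_t_unitary E).
rewrite -rt !image_comp; apply: eq_imagel => u _ /=.
exact: cr_comm.
Qed.

(** The projection onto the range of [Vtilde12] is that of [V i] minus the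
    projection onto [V i (E_i (x) W_j)], so that the terms of [V i] cancel and
    a difference of two projections is left. *)
Lemma joint_defectE i j h : i != j ->
  joint_defect V h = proj (wandering V j) h -
    Vtilde V (proj (tens_wandering V i j) (adj (Vtilde V (i := i)) h)).
Proof.
move=> ij; have iT := isometry_Vtilde i.
have hN : closed_subspace (tens_wandering V i j) by exact: closed_subspace_cspan.
rewrite proj_orthoE; last exact: closed_subspace_range (isometry_Vtilde j).
rewrite /joint_defect -!(proj_range (isometry_Vtilde _)) -(proj_range isometry_Vtilde12).
rewrite (range_Vtilde12 ij) (proj_image iT); last exact: closed_subspace_ortho.
rewrite proj_orthoE // (linear_sub iT.1) -(proj_range iT).
case/ord2_neq: ij => -[-> ->]; last by rewrite subrKA.
by rewrite [X in X + _ = _]addrAC subrKA.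
Qed.

End IsometricRep.

Theorem theorem4p5 (R : realType) (A : cstarAlgType R) (E : product_system A)
    (H : hilbertType R) (sigma : representation A H)
    (K : tensor_spaces E sigma) (V : covariant_rep K)
    (V_isometric : isometric V) (i j : 'I_2) (neq_ij : i != j) :
  compact_op (joint_defect V) <->
    compact_op_on (wandering V j)
      (fun h : H => h - fringe V i j (fringe_adj V i j h)) /\
    compact_op_on (tens_wandering V i j)
      (fun u : K i => u - fringe_adj V i j (fringe V i j u)).
Proof.
have iT := isometry_Vtilde V_isometric i.
have hN : closed_subspace (tens_wandering V i j) by exact: closed_subspace_cspan.
have hW : closed_subspace (wandering V j) by exact: closed_subspace_ortho.
have adjE h : wandering V j h ->
    fringe_adj V i j h = proj (tens_wandering V i j) (adj (Vtilde V (i := i)) h).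
  move=> Wh; rewrite /fringe_adj.
  apply: (adj_onE (S := fun h => proj _ (adj _ h)) hN _ Wh) => y Wy.
  split=> [|u Nu]; first exact: proj_in.
  rewrite /fringe dot_proj // (proj_id hW Wy) (dot_adj (isometry_bounded iT)).
  by rewrite -dot_proj // proj_id.
have := compact_proj_diff iT hW hN.
rewrite /compact_op.
rewrite -(eq_compact_op_on (fun h _ => joint_defectE V_isometric h neq_ij)).
rewrite -(@eq_compact_op_on _ _ _ (wandering V j)
  (fun h : H => h - fringe V i j (fringe_adj V i j h))); last first.
  by move=> h Wh; rewrite adjE.
rewrite -(@eq_compact_op_on _ _ _ (tens_wandering V i j)
  (fun u : K i => u - fringe_adj V i j (fringe V i j u))) //.
by move=> u Nu; rewrite adjE //; exact: (proj_in hW).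
Qed.
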